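(* Let $\ell\ge 0$ be an integer and $n=2\ell+1$. Let $\mathfrak{c}=\mathfrak{so}(n)\ltimes\mathbb{C}^n$ be the common Lie algebra of $IO(n)=O(n)\ltimes\mathbb{C}^n$ and $ISO(n)=SO(n)\ltimes\mathbb{C}^n$. Let $J$ (resp. $Y(\mathfrak{c})$) be the algebra of polynomial functions on $\mathfrak{c}^*$ invariant under the coadjoint action of $IO(n)$ (resp. of $ISO(n)$). For $0\le k\le \ell$ let $\psi_k:\mathfrak{c}^*\to\mathbb{C}$ be the polynomial function $\psi_k(y,w^* )=-w^*B_{2k}(y)\,{}^tw^*$. Let $\Phi$ be the unique element of $Y(\mathfrak{c})$ whose restriction to the subspace $\mathfrak{h}\subset\mathfrak{c}^*$ is $\varphi_\ell$ (such an element exists and is unique; $\mathfrak{h}$ and $\varphi_\ell$ are defined in the context). Then $$J=\mathbb{C}[\psi_0,\dots,\psi_\ell]\qquad\text{and}\qquad Y(\mathfrak{c})=\mathbb{C}[\psi_0,\dots,\psi_{\ell-1},\Phi].$$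
   Context: The base field is $\mathbb{C}$. $\mathbb{C}^n$ is identified with column matrices and its dual with row matrices; ${}^tX$ denotes the transpose of $X$. $O(n)$, $SO(n)$ are the complex orthogonal and special orthogonal groups, and $\mathfrak{so}(n)$ is the Lie algebra of antisymmetric complex $n\times n$ matrices. For $x\in M_n(\mathbb{C})$ define $p_1(x),\dots,p_n(x)$ by $\det(tI_n-x)=t^n-p_1(x)t^{n-1}-\cdots-p_n(x)$, and set $B_0(x)=I_n$ and $B_k(x)=x^k-p_1(x)x^{k-1}-\cdots-p_k(x)I_n$ for $1\le k\le n-1$. The groups $IO(n)$ and $ISO(n)$ are semidirect products for the natural action, with law $(g,u)(g',u')=(gg',u+gu')$. The Lie algebra $\mathfrak{c}=\mathfrak{so}(n)\times\mathbb{C}^n$ has $[(x,0),(0,u)]=(0,xu)$, with $\mathbb{C}^n$ an abelian ideal. The dual $\mathfrak{c}^*$ is identified with the set of pairs $(y,w^* )$, with $y\in\mathfrak{so}(n)$ and $w^*$ a row vector, through the pairing $\langle(y,w^* ),(x,u)\rangle=\operatorname{tr}(yx)+2w^*u$. (This is the pairing obtained by embedding $\mathfrak{c}$ into $\mathfrak{gl}(n)\ltimes(\mathbb{C}^n\oplus(\mathbb{C}^n)^* )$ via $(x,u)\mapsto(x,u,-{}^tu)$ and identifying $(y,w^* )$ with $(y,w^*,-{}^tw^* )$.) The coadjoint action is $\langle Ad^*(h)\lambda,X\rangle=\langle\lambda,Ad(h^{-1})X\rangle$. The symmetric algebra $S(\mathfrak{c})$ is identified with the algebra of polynomial functions on $\mathfrak{c}^*$.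 For $n=2\ell+1$, $\mathfrak{h}\subset\mathfrak{c}^*$ is the subspace of all pairs $(z,ae_n^* )$, where $a\in\mathbb{C}$, $e_n^*=(0,\dots,0,1)$, and $z$ is the block diagonal matrix with diagonal blocks $\begin{pmatrix}0&a_1\\-a_1&0\end{pmatrix},\dots,\begin{pmatrix}0&a_\ell\\-a_\ell&0\end{pmatrix}$ followed by a $1\times1$ zero block, with $(a_1,\dots,a_\ell)\in\mathbb{C}^\ell$. The function $\varphi_\ell:\mathfrak{h}\to\mathbb{C}$ is $\varphi_\ell(z,ae_n^* )=a\,a_1a_2\cdots a_\ell$. *)

(* Defs.v *)
From HB Require Import structures.
From mathcomp Require Import all_boot all_order all_algebra.
From mathcomp Require Import mpoly.

Set Implicit Arguments.
Unset Strict Implicit.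
Unset Printing Implicit Defensive.

Import GRing.Theory Num.Theory.
Local Open Scope ring_scope.

Section Definitions.
Variables (F : numFieldType) (n : nat).

Record so := So { so_val :> 'M[F]_n; so_skew : so_val^T == - so_val }.
HB.instance Definition _ := [isSub for so_val].

Record orth :=
  Orth { orth_val :> 'M[F]_n; orth_eq : orth_val^T *m orth_val == 1%:M }.
HB.instance Definition _ := [isSub for orth_val].

Lemma orth_unit (g : orth) : (g : 'M_n) \in unitmx.
Proof. by case/mulmx1_unit: (eqP (orth_eq g)). Qed.

Lemma orth_inv (g : orth) : invmx g = (g : 'M_n)^T.
Proof.
by rewrite -[RHS](mulmxK (orth_unit g)) (eqP (orth_eq g)) mul1mx.
Qed.

Lemma orthM_proof (g g' : orth) :
  ((g : 'M_n) *m g')^T *m ((g : 'M_n) *m g') == 1%:M.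
Proof.
by rewrite trmx_mul -mulmxA [_ *m (_ *m g')]mulmxA (eqP (orth_eq g)) mul1mx
  orth_eq.
Qed.
Definition orthM (g g' : orth) : orth := Orth (orthM_proof g g').

Lemma orthV_proof (g : orth) : (invmx g)^T *m invmx g == 1%:M.
Proof. by rewrite orth_inv trmxK -orth_inv mulmxV ?orth_unit. Qed.
Definition orthV (g : orth) : orth := Orth (orthV_proof g).

Lemma orth1_proof : (1%:M : 'M[F]_n)^T *m 1%:M == 1%:M.
Proof. by rewrite trmx1 mul1mx. Qed.
Definition orth1 : orth := Orth orth1_proof.

Definition IO : Type := (orth * 'cV[F]_n)%type.
Definition IO1 : IO := (orth1, 0).
Definition IOmul (h h' : IO) : IO :=
  (orthM h.1 h'.1, h.2 + (h.1 : 'M_n) *m h'.2).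
Definition IOinv (h : IO) : IO := (orthV h.1, - (invmx h.1 *m h.2)).

Lemma IOmulV (h : IO) : IOmul h (IOinv h) = IO1.
Proof.
case: h => g u; congr pair; first by apply: val_inj; rewrite /= mulmxV ?orth_unit.
by rewrite /= mulmxN mulKVmx ?orth_unit ?subrr.
Qed.

Definition isISO (h : IO) : Prop := \det (h.1 : 'M_n) = 1.

(* As a vector space, the Lie algebra so(n) |x C^n. *)
Definition lieC : Type := (so * 'cV[F]_n)%type.

Lemma conj_skew (g : orth) (x : so) :
  ((g : 'M_n) *m x *m invmx g)^T == - ((g : 'M_n) *m x *m invmx g).
Proof.
by rewrite !trmx_mul orth_inv trmxK (eqP (so_skew x)) mulNmx mulmxN mulmxA.
Qed.

(* The adjoint action.  It is conjugation after embedding group and Lie algebra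
   in the affine matrices of size n + 1: see [Ad_affine]. *)
Definition Ad (h : IO) (X : lieC) : lieC :=
  (So (conj_skew h.1 X.1),
   (h.1 : 'M_n) *m X.2 - (h.1 : 'M_n) *m X.1 *m invmx h.1 *m h.2).

Definition affine_group (h : IO) : 'M[F]_(n + 1) :=
  block_mx (h.1 : 'M_n) h.2 0 1%:M.
Definition affine_lie (X : lieC) : 'M[F]_(n + 1) :=
  block_mx (X.1 : 'M_n) X.2 0 0.

Lemma affine_groupM (h h' : IO) :
  affine_group (IOmul h h') = affine_group h *m affine_group h'.
Proof.
rewrite mulmx_block !mulmx0 !mul0mx !mulmx1 !addr0 add0r.
by rewrite [_ *m h'.2 + _]addrC.
Qed.

Lemma affine_lie_bracket (X Y : lieC) :
  affine_lie X *m affine_lie Y - affine_lie Y *m affine_lie X =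
  block_mx ((X.1 : 'M_n) *m Y.1 - (Y.1 : 'M_n) *m X.1)
           ((X.1 : 'M_n) *m Y.2 - (Y.1 : 'M_n) *m X.2) 0 0.
Proof.
by rewrite !mulmx_block opp_block_mx add_block_mx !mulmx0 !mul0mx !addr0 !subr0.
Qed.

Lemma Ad_affine (h : IO) (X : lieC) :
  affine_lie (Ad h X) = affine_group h *m affine_lie X *m affine_group (IOinv h).
Proof.
rewrite !mulmx_block !mulmx0 !mul0mx !mulmx1 !addr0 !mulmxN !mulmxA.
by rewrite !mul0mx oppr0 [- _ + _]addrC.
Qed.

Definition dualC : Type := (so * 'rV[F]_n)%type.

Definition pairing (lam : dualC) (X : lieC) : F :=
  \tr ((lam.1 : 'M_n) *m X.1) + 2 * (lam.2 *m X.2) 0 0.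

(* [is_coad h lam mu] says that mu = Ad^*(h) lam; it is the graph of a function
   of (h, lam) by [coad_exists_unique]. *)
Definition is_coad (h : IO) (lam mu : dualC) : Prop :=
  forall X : lieC, pairing mu X = pairing lam (Ad (IOinv h) X).

(* Polynomials in all the entries of (y, w); those of y are redundant
   coordinates, being subject to y_ij = - y_ji. *)
Definition dual_coord (lam : dualC) (i : 'I_(n * n + n)) : F :=
  row_mx (mxvec (lam.1 : 'M_n)) lam.2 0 i.
Definition polynomial_function (f : dualC -> F) : Prop :=
  exists p : {mpoly F[n * n + n]}, forall lam, f lam = p.@[dual_coord lam].

Definition J (f : dualC -> F) : Prop :=
  polynomial_function f /\
  forall (h : IO) (lam mu : dualC), is_coad h lam mu -> f mu = f lam.

Definition Yc (f : dualC -> F) : Prop :=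
  polynomial_function f /\
  forall (h : IO) (lam mu : dualC), isISO h -> is_coad h lam mu -> f mu = f lam.

(* The subalgebra F[gen_0, ..., gen_(m-1)] of the algebra of functions on T. *)
Definition generated (T : Type) (m : nat) (gen : 'I_m -> T -> F) (f : T -> F) :
    Prop :=
  exists P : {mpoly F[m]}, forall t, f t = P.@[fun i => gen i t].

(* det (t I_n - x) = t^n - p_1(x) t^(n-1) - ... - p_n(x); only for 1 <= k <= n. *)
Definition p_coef (k : nat) (x : 'M[F]_n) : F := - (char_poly x)`_(n - k).

Definition B (k : nat) (x : 'M[F]_n) : 'M[F]_n :=
  x ^+ k - \sum_(1 <= i < k.+1) p_coef i x *: x ^+ (k - i).

Definition psi (k : nat) (lam : dualC) : F :=
  - (lam.2 *m B k.*2 lam.1 *m lam.2^T) 0 0.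

End Definitions.

Section Cartan.
Variables (F : numFieldType) (l : nat).
Let n := l.*2.+1.

Definition h_mx (a : 'I_l -> F) : 'M[F]_n :=
  \sum_(k < l) a k *: (delta_mx (inord k.*2) (inord k.*2.+1)
                       - delta_mx (inord k.*2.+1) (inord k.*2)).

Lemma h_skew (a : 'I_l -> F) : (h_mx a)^T == - h_mx a.
Proof.
rewrite /h_mx raddf_sum -sumrN; apply/eqP/eq_bigr => k _.
by rewrite [LHS]linearZ /= [X in _ *: X]linearB /= !trmx_delta -scalerN opprB.
Qed.

(* The point of h with parameters (a_1, ..., a_l) and b (the coefficient of e_n^* ). *)
Definition h_point (a : 'I_l -> F) (b : F) : dualC F n :=
  (So (h_skew a), b *: delta_mx 0 ord_max).

Definition restricts_to_phi (f : dualC F n -> F) : Prop :=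
  forall (a : 'I_l -> F) (b : F), f (h_point a b) = b * \prod_(k < l) a k.

End Cartan.

Section Coadjoint.
Variables (F : numFieldType) (n : nat).

Lemma skew_part_proof (m : 'M[F]_n) : (m - m^T)^T == - (m - m^T).
Proof. by rewrite linearB /= trmxK opprB. Qed.
Definition skew_part (m : 'M[F]_n) : so F n := So (skew_part_proof m).

Lemma pairing_inj (lam mu : dualC F n) :
  (forall X, pairing lam X = pairing mu X) -> lam = mu.
Proof.
have two0 : (2 : F) != 0 by rewrite pnatr_eq0.
case: lam mu => [y w] [y' w'] eq_p; congr pair; last first.
  apply/rowP => i; pose X : lieC F n := (skew_part 0, delta_mx i 0).
  have := eq_p X; rewrite /pairing /= trmx0 subr0 !mulmx0 !raddf0 !add0r.
  by rewrite -!colE !mxE => /(mulfI two0).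
have tr_delta (m : 'M[F]_n) i j : \tr (m *m delta_mx j i) = m i j.
  rewrite -(mul_delta_mx (0 : 'I_1)) mulmxA mxtrace_mulC -colE -rowE.
  by rewrite /mxtrace big_ord1 !mxE.
have tr_skew (z : so F n) i j :
    \tr ((z : 'M_n) *m skew_part (delta_mx j i)) = 2 * (z : 'M_n) i j.
  rewrite /= trmx_delta mulmxBr raddfB /= !tr_delta.
  have /eqP/matrixP/(_ i j) := so_skew z; rewrite !mxE => ->.
  by rewrite opprK mulr_natl mulr2n.
apply: val_inj; apply/matrixP => i j.
have := eq_p (skew_part (delta_mx j i), 0).
by rewrite /pairing !mulmx0 !mxE !mulr0 !addr0 !tr_skew => /(mulfI two0).
Qed.

Lemma coad_proof (h : IO F n) (lam : dualC F n) (w := lam.2 *m invmx h.1) :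
  ((h.1 : 'M_n) *m lam.1 *m invmx h.1 + skew_part (h.2 *m w))^T ==
  - ((h.1 : 'M_n) *m lam.1 *m invmx h.1 + skew_part (h.2 *m w)).
Proof.
rewrite linearD /= (eqP (conj_skew _ _)) [X in _ + X](eqP (skew_part_proof _)).
by rewrite -opprD.
Qed.
Definition coad (h : IO F n) (lam : dualC F n) : dualC F n :=
  (So (coad_proof h lam), lam.2 *m invmx h.1).

Lemma coadP (h : IO F n) (lam : dualC F n) : is_coad h lam (coad h lam).
Proof.
case: h lam => g u [y w] [x v]; rewrite /pairing /=.
have inv2 : invmx (invmx g) = g by rewrite invmxK.
rewrite inv2 mulmxDl raddfD /= -addrA; congr (_ + _).
  by rewrite -!mulmxA mxtrace_mulC !mulmxA.
set w' := w *m invmx g.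
rewrite mulmxN opprK -[_ *m g *m _]mulmxA mulKVmx ?orth_unit // mulmxDr !mulmxA.
rewrite -/w' [X in _ = 2 * X]mxE mulrDr addrC; congr (_ + _).
have trE : \tr (u *m w' *m x) = (w' *m x *m u) 0 0.
  by rewrite -mulmxA mxtrace_mulC /mxtrace big_ord1.
rewrite -[u *m w *m _]mulmxA -/w' mulmxBl raddfB /= trE -[X in _ - X]mxtrace_tr trmx_mul trmxK.
by rewrite (eqP (so_skew x)) mulNmx raddfN /= mxtrace_mulC trE opprK mulr_natl.
Qed.

Lemma coad_exists_unique (h : IO F n) (lam : dualC F n) :
  exists! mu, is_coad h lam mu.
Proof.
exists (coad h lam); split=> [|mu mu_h]; first exact: coadP.
by apply: pairing_inj => X; rewrite mu_h coadP.
Qed.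

End Coadjoint.

(* Main.v *)
Require Import Defs.
From Stdlib Require Import FunctionalExtensionality.
From mathcomp Require Import all_boot all_order all_algebra.
From mathcomp Require Import monoid perm complex reals mpoly separable.
From mathcomp Require Import ring.

Set Implicit Arguments.
Unset Strict Implicit.
Unset Printing Implicit Defensive.

Import GRing.Theory Num.Theory.
Local Open Scope ring_scope.

(* Write Psi(y, w) = - w adj(X - y) w^T, a polynomial in X^2 whose coefficients are
   the psi_k, and let Phi be the normalized Pfaffian of the bordered skew matrix
   [[y, w^T], [-w, 0]].  Both are values of bordered matrices on which IO(n) acts by
   congruence, so Psi is invariant and Phi is multiplied by det g.
   If w w^T <> 0, a translation moves (y, w) to a point with w y = 0, and there
   X Psi(y, w) = - (w w^T) char_poly y.  Hence if moreover the eigenvalues are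
   distinct (a nonvanishing condition on a polynomial, discr), the orbit under IO(n)
   is determined by Psi: one can conjugate by an orthogonal matrix, of determinant 1 as
   soon as the two values of Phi agree and are not 0.  Such a generic point is in
   particular linked to a point of h, which gives psi_l = - Phi^2 and the uniqueness
   of Phi.
   Finally there is an affine slice c |-> slice c with psi_k (slice c) = c_k for k < l
   and psi_l (slice c) = - c_l^2.  A function f in Y(c) satisfies
   f = f (slice (psi_0, ..., psi_(l-1), +- Phi)) at generic points, hence everywhere,
   and this is a polynomial in the generators; for f in J the sign of Phi can be
   chosen freely, so that only Phi^2 = - psi_l occurs. *)

(** * Polynomial functions *)

Section GeneratedFunctions.
Variables (F : numFieldType) (T : Type) (m : nat) (gen : 'I_m -> T -> F).
Local Notation G := (generated gen).

Lemma generated_ext (f g : T -> F) : f =1 g -> G f -> G g.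
Proof. by move=> fg [P PE]; exists P => t; rewrite -fg. Qed.

Lemma generated_gen i : G (gen i).
Proof. by exists 'X_i => t; rewrite mevalXU. Qed.

Lemma generated_const c : G (fun _ => c).
Proof. by exists c%:MP => t; rewrite mevalC. Qed.

Lemma generatedD f g : G f -> G g -> G (fun t => f t + g t).
Proof.
by move=> [P PE] [Q QE]; exists (P + Q) => t; rewrite mevalD PE QE.
Qed.

Lemma generatedM f g : G f -> G g -> G (fun t => f t * g t).
Proof.
by move=> [P PE] [Q QE]; exists (P * Q) => t; rewrite mevalM PE QE.
Qed.

Lemma generatedN f : G f -> G (fun t => - f t).
Proof. by move=> [P PE]; exists (- P) => t; rewrite mevalN PE. Qed.

Lemma generatedB f g : G f -> G g -> G (fun t => f t - g t).
Proof. by move=> Gf Gg; apply/generatedD/generatedN. Qed.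

Lemma generated_sum (I : Type) (r : seq I) (p : pred I) (f : I -> T -> F) :
  (forall i, p i -> G (f i)) -> G (fun t => \sum_(i <- r | p i) f i t).
Proof.
move=> Gf; elim: r => [|i r IHr].
  by apply: (generated_ext _ (generated_const 0)) => t; rewrite big_nil.
have [pi|npi] := boolP (p i); last first.
  by apply: (generated_ext _ IHr) => t; rewrite big_cons (negPf npi).
apply: (generated_ext _ (generatedD (Gf i pi) IHr)) => t.
by rewrite big_cons pi.
Qed.

Lemma generated_prod (I : Type) (r : seq I) (p : pred I) (f : I -> T -> F) :
  (forall i, p i -> G (f i)) -> G (fun t => \prod_(i <- r | p i) f i t).
Proof.
move=> Gf; elim: r => [|i r IHr].
  by apply: (generated_ext _ (generated_const 1)) => t; rewrite big_nil.
have [pi|npi] := boolP (p i); last first.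
  by apply: (generated_ext _ IHr) => t; rewrite big_cons (negPf npi).
apply: (generated_ext _ (generatedM (Gf i pi) IHr)) => t.
by rewrite big_cons pi.
Qed.

Lemma generatedX f k : G f -> G (fun t => f t ^+ k).
Proof.
move=> Gf; elim: k => [|k IHk]; first exact: generated_const.
by apply: (generated_ext _ (generatedM Gf IHk)) => t; rewrite exprS.
Qed.

Lemma generated_mulmx (a b c : nat) (A : T -> 'M_(a, b)) (C : T -> 'M_(b, c)) :
  (forall i j, G (fun t => A t i j)) -> (forall i j, G (fun t => C t i j)) ->
  forall i j, G (fun t => (A t *m C t) i j).
Proof.
move=> GA GC i j.
apply: (generated_ext (f := fun t => \sum_k A t i k * C t k j)) => [t|].
  by rewrite mxE.
by apply: generated_sum => k _; apply: generatedM.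
Qed.

Lemma generated_det (a : nat) (A : T -> 'M_a) :
  (forall i j, G (fun t => A t i j)) -> G (fun t => \det (A t)).
Proof.
move=> GA; apply: generated_sum => s _; apply: generatedM.
  exact: generated_const.
by apply: generated_prod => i _; apply: GA.
Qed.

Definition pgenerated (g : T -> {poly F}) := forall j, G (fun t => (g t)`_j).

Lemma pgenerated_ext f g : f =1 g -> pgenerated f -> pgenerated g.
Proof. by move=> fg Gf j; apply: (generated_ext _ (Gf j)) => t; rewrite fg. Qed.

Lemma pgenerated_const p : pgenerated (fun _ => p).
Proof. by move=> j; apply: generated_const. Qed.

Lemma pgeneratedC f : G f -> pgenerated (fun t => (f t)%:P).
Proof.
move=> Gf j; apply: (generated_ext (f := fun t => if j == 0 then f t else 0)).
  by move=> t; rewrite coefC.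
by case: eqP => _ //; apply: generated_const.
Qed.

Lemma pgeneratedD f g :
  pgenerated f -> pgenerated g -> pgenerated (fun t => f t + g t).
Proof.
move=> Gf Gg j; apply: (generated_ext _ (generatedD (Gf j) (Gg j))) => t.
by rewrite coefD.
Qed.

Lemma pgeneratedN f : pgenerated f -> pgenerated (fun t => - f t).
Proof.
by move=> Gf j; apply: (generated_ext _ (generatedN (Gf j))) => t; rewrite coefN.
Qed.

Lemma pgeneratedM f g :
  pgenerated f -> pgenerated g -> pgenerated (fun t => f t * g t).
Proof.
move=> Gf Gg j.
apply: (generated_ext (f := fun t => \sum_(i < j.+1) (f t)`_i * (g t)`_(j - i))).
  by move=> t; rewrite coefM.
by apply: generated_sum => k _; apply: generatedM.
Qed.

Lemma pgenerated_sum (I : Type) (r : seq I) (p : pred I) f :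
  (forall i : I, p i -> pgenerated (f i)) ->
  pgenerated (fun t => \sum_(i <- r | p i) f i t).
Proof.
move=> Gf j.
apply: (generated_ext (f := fun t => \sum_(i <- r | p i) (f i t)`_j)) => [t|].
  by rewrite coef_sum.
by apply: generated_sum => i pi; apply: Gf.
Qed.

Lemma pgenerated_prod (I : Type) (r : seq I) (f : I -> T -> {poly F}) :
  (forall i, pgenerated (f i)) ->
  pgenerated (fun t => \prod_(i <- r) f i t).
Proof.
move=> Gf; elim: r => [|i r IHr].
  by apply: (pgenerated_ext _ (pgenerated_const 1)) => t; rewrite big_nil.
by apply: (pgenerated_ext _ (pgeneratedM (Gf i) IHr)) => t; rewrite big_cons.
Qed.

Lemma pgenerated_det (a : nat) (A : T -> 'M_a) :
  (forall i j, pgenerated (fun t => A t i j)) ->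
  pgenerated (fun t => \det (A t)).
Proof.
move=> GA; apply: pgenerated_sum => s _; apply: pgeneratedM.
  exact: pgenerated_const.
by apply: pgenerated_prod.
Qed.

Lemma pgenerated_char_poly (a : nat) (A : T -> 'M_a) :
  (forall i j, G (fun t => A t i j)) -> pgenerated (fun t => char_poly (A t)).
Proof.
move=> GA; apply: pgenerated_det => i j.
apply: (@pgenerated_ext (fun t => 'X *+ (i == j) - (A t i j)%:P)).
  by move=> t; rewrite !mxE.
by apply: pgeneratedD; [apply: pgenerated_const | apply/pgeneratedN/pgeneratedC].
Qed.

End GeneratedFunctions.

(** Substitution, carried out by expanding [P] into monomials and using the closure properties
    above. *)
Lemma generated_comp (F : numFieldType) (T U : Type) (m k : nat)
    (gen : 'I_m -> T -> F) (gen' : 'I_k -> U -> F) (u : U -> T) (f : T -> F) :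
  (forall i, generated gen' (fun x => gen i (u x))) ->
  generated gen f -> generated gen' (fun x => f (u x)).
Proof.
move=> Gu [P PE]; pose h (x : U) := P.@[fun i => gen i (u x)].
apply: (generated_ext (f := h)) => [x|]; first by rewrite PE.
apply: (generated_ext (f := fun x =>
  \sum_(e <- msupp P) P@_e * \prod_i gen i (u x) ^+ e i)) => [x|].
  by rewrite /h mevalE.
apply: generated_sum => e _; apply: generatedM; first exact: generated_const.
by apply: generated_prod => i _; apply: generatedX.
Qed.

(* Along the path g from x to x0, the product D f is the zero polynomial. *)
Lemma generated_dense (F : numFieldType) (T : Type) (m : nat)
    (gen : 'I_m -> T -> F) (D f : T -> F) (x x0 : T) (g : F -> T) :
  (forall i, generated (fun (_ : 'I_1) (t : F) => t) (fun t => gen i (g t))) ->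
  (forall i, gen i (g 0) = gen i x) -> (forall i, gen i (g 1) = gen i x0) ->
  generated gen D -> generated gen f -> D x0 != 0 ->
  (forall y, D y * f y = 0) -> f x = 0.
Proof.
move=> Gg g0 g1 GD Gf nzD Df0.
have poly_of (h : T -> F) : generated gen h ->
    exists2 p : {poly F}, (forall t, h (g t) = p.[t]) & h (g 0) = h x /\ h (g 1) = h x0.
  move=> Gh; have [P PE] := generated_comp Gg Gh.
  exists (\sum_(e <- msupp P) P@_e *: 'X^(e ord0)) => [t|].
    rewrite PE mevalE horner_sum; apply: eq_bigr => e _.
    by rewrite big_ord1 hornerZ hornerXn.
  by case: Gh => Q QE; rewrite !QE; split; apply: meval_eq.
have [p pE [p0 p1]] := poly_of _ Gf; have [q qE [q0 q1]] := poly_of _ GD.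
have : q * p == 0.
  apply: contraT => nz_qp.
  (* A nonzero [q * p] would have too many roots: the natural numbers below its size, which are
     distinct in characteristic 0. *)
  have : (size [seq i%:R : F | i <- iota 0 (size (q * p)%R)]%R < size (q * p)%R)%N.
    apply: max_poly_roots => //; last first.
      by rewrite map_inj_in_uniq ?iota_uniq // => i j _ _ /eqP;
         rewrite eqr_nat => /eqP.
    by apply/allP => y _; rewrite /root hornerM -pE -qE Df0.
  by rewrite size_map size_iota ltnn.
rewrite mulf_eq0 => /orP[] /eqP p_0; last by rewrite -p0 pE p_0 horner0.
by move: nzD; rewrite -q1 qE p_0 horner0 eqxx.
Qed.

(** * Polynomial functions on the dual and density along affine lines *)

Section DualCoordinates.
Variables (F : numFieldType) (n : nat).
Implicit Types (lam mu : dualC F n) (f g : dualC F n -> F).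

Lemma polynomial_functionE f :
  polynomial_function f <-> generated (fun i lam => dual_coord lam i) f.
Proof. by []. Qed.

Lemma polynomial_y i j :
  polynomial_function (fun lam : dualC F n => (lam.1 : 'M_n) i j).
Proof.
apply/polynomial_functionE.
apply: (generated_ext _ (generated_gen _ (lshift n (mxvec_index i j)))) => lam.
by rewrite /dual_coord row_mxEl mxvecE.
Qed.

Lemma polynomial_w i j : polynomial_function (fun lam : dualC F n => lam.2 i j).
Proof.
apply/polynomial_functionE.
apply: (generated_ext _ (generated_gen _ (rshift (n * n) j))) => lam.
by rewrite /dual_coord row_mxEr (ord1 i).
Qed.

Lemma line_skew lam mu (t : F) :
  ((lam.1 : 'M_n) + t *: (mu.1 : 'M_n))^T == - ((lam.1 : 'M_n) + t *: (mu.1 : 'M_n)).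
Proof.
by rewrite linearD linearZ /= (eqP (so_skew _)) (eqP (so_skew _)) opprD scalerN.
Qed.
Definition line lam mu (t : F) : dualC F n :=
  (So (line_skew lam mu t), lam.2 + t *: mu.2).

Lemma lineE lam mu t i :
  dual_coord (line lam mu t) i = dual_coord lam i + t * dual_coord mu i.
Proof.
rewrite /dual_coord !mxE; case: splitP => j _; last by rewrite !mxE.
by rewrite linearD linearZ /= !mxE.
Qed.

Lemma so_eq (x y : so F n) : (x : 'M_n) = y -> x = y.
Proof. by move=> xy; apply: val_inj. Qed.

Lemma dual_eq lam mu : (lam.1 : 'M_n) = mu.1 -> lam.2 = mu.2 -> lam = mu.
Proof. by case: lam mu => [y w] [y' w'] /= /so_eq -> ->. Qed.

Lemma polynomial_function_dense (D f g : dualC F n -> F) mu :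
  polynomial_function D -> polynomial_function f -> polynomial_function g ->
  D mu != 0 -> (forall lam, D lam != 0 -> f lam = g lam) -> f =1 g.
Proof.
move=> PD Pf Pg Dmu fg lam; apply/eqP; rewrite -subr_eq0; apply/eqP.
(* [d] is [mu - lam], so the line runs from [lam] at 0 to [mu] at 1. *)
pose d := line mu lam (-1).
apply: (@generated_dense F (dualC F n) _ (fun i lam => dual_coord lam i) D
  (fun lam => f lam - g lam) lam mu (line lam d)) => //.
- move=> i; apply: (generated_ext (fun t => esym (lineE lam d t i))).
  apply: generatedD; first exact: generated_const.
  apply: generatedM; last exact: generated_const.
  exact: (generated_gen (fun _ t => t) ord0).
- by move=> i; rewrite lineE mul0r addr0.
- by move=> i; rewrite !lineE mul1r mulN1r addrC subrK.
- exact: generatedB.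
move=> y; have [->|nzD] := eqVneq (D y) 0; first by rewrite mul0r.
by rewrite fg // subrr mulr0.
Qed.

End DualCoordinates.
(** * The Pfaffian *)

Section SkewDeterminant.
Variables (R : comPzRingType) (N m : nat).
Variables (e : 'I_m * bool -> 'I_N) (e' : 'I_N -> 'I_m * bool).

(* When e is a bijection, so that N = 2m, this is 2^m m! times the Pfaffian of
   A, up to sign. *)
Definition pfaffian (A : 'M[R]_N) : R :=
  \sum_(s : 'S_N) (-1) ^+ s * \prod_i A (s (e (i, false))) (s (e (i, true))).

Hypotheses (eK : cancel e e') (e'K : cancel e' e).

Lemma prod_pairs (f : 'I_N -> R) :
  \prod_p f p = \prod_i (f (e (i, true)) * f (e (i, false))).
Proof.
rewrite (reindex e) /=; last by exists e' => x _; rewrite ?eK ?e'K.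
rewrite (eq_bigr (fun p => f (e (p.1, p.2)))) => [|[] //].
rewrite -(pair_bigA _ (fun i b => f (e (i, b)))) /=.
by apply: eq_bigr => i _; rewrite big_bool.
Qed.

(** Distributivity: a choice of one pair of indices for each [i] is a map on all [N] indices, read
    through the bijection [e]. *)
Lemma sum_ffun_pairs (H : 'I_m -> 'I_N -> 'I_N -> R) :
  \prod_i \sum_j \sum_k H i j k =
  \sum_(f : {ffun 'I_N -> 'I_N}) \prod_i H i (f (e (i, false))) (f (e (i, true))).
Proof.
under eq_bigr => i _ do rewrite (pair_bigA _ (H i)).
rewrite bigA_distr_bigA.
pose h (f : {ffun 'I_N -> 'I_N}) : {ffun 'I_m -> 'I_N * 'I_N} :=
  [ffun i => (f (e (i, false)), f (e (i, true)))].
pose h' (f : {ffun 'I_m -> 'I_N * 'I_N}) : {ffun 'I_N -> 'I_N} :=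
  [ffun p => if (e' p).2 then (f (e' p).1).2 else (f (e' p).1).1].
rewrite (reindex h) /=; last first.
  exists h' => f _; apply/ffunP => x; rewrite !ffunE ?eK /=.
    by rewrite -[in RHS](e'K x); case: (e' x) => i [].
  by case: (f x).
by apply: eq_bigr => f _; apply: eq_bigr => i _; rewrite ffunE.
Qed.

(** Expanding each entry and summing over [s] first leaves, for each map [f] of the summation
    indices, a determinant whose rows are the columns [f i] of [g]. It vanishes unless [f] is a
    permutation, and then it is [\det g] times the sign of [f]. *)
Lemma pfaffian_congr (g A : 'M[R]_N) :
  pfaffian (g *m A *m g^T) = \det g * pfaffian A.
Proof.
pose c (f : {ffun 'I_N -> 'I_N}) := \prod_i A (f (e (i, false))) (f (e (i, true))).
have -> : pfaffian (g *m A *m g^T) =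
    \sum_(f : {ffun 'I_N -> 'I_N}) c f * \det (\matrix_(i, j) g j (f i)).
  rewrite /pfaffian.
  pose H (s : 'S_N) i j k :=
    A j k * (g (s (e (i, true))) k * g (s (e (i, false))) j).
  transitivity (\sum_(s : 'S_N) \sum_(f : {ffun 'I_N -> 'I_N})
     (-1) ^+ s * \prod_i H s i (f (e (i, false))) (f (e (i, true)))).
    apply: eq_bigr => s _; rewrite -mulr_sumr -sum_ffun_pairs; congr (_ * _).
    apply: eq_bigr => i _; rewrite mxE exchange_big; apply: eq_bigr => k _.
    rewrite !mxE mulr_suml; apply: eq_bigr => j _.
    by rewrite /H mulrC [LHS]mulrA [LHS]mulrC.
  rewrite exchange_big; apply: eq_bigr => f _; rewrite mulr_sumr.
  apply: eq_bigr => s _; rewrite mulrCA; congr (_ * _).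
  by rewrite prod_pairs -big_split; apply: eq_bigr => i _; rewrite !mxE.
rewrite (bigID (fun f : {ffun 'I_N -> 'I_N} => injectiveb f)) /=.
rewrite addrC big1 ?add0r; last first.
  move=> f /injectivePn[i1 [i2 ne_i eq_f]].
  rewrite (determinant_alternate ne_i) ?mulr0 // => j.
  by rewrite !mxE eq_f.
rewrite (reindex (fun s : 'S_N => pval s)) /=; last first.
  pose h (f : {ffun 'I_N -> 'I_N}) := insubd (1%g : 'S_N) f.
  exists h => [s _|f /= inj_f]; first by rewrite /h valKd.
  by rewrite /h [LHS]val_insubd; move: inj_f; rewrite inE => ->.
rewrite mulr_sumr; apply: eq_big => [s|s _]; first by rewrite (valP s).
rewrite -[X in _ * X]det_tr.
have -> : (\matrix_(i, j) g j ((pval s) i))^T = g *m perm_mx (s^-1)%g.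
  by rewrite -col_permE; apply/matrixP => i j; rewrite !mxE pvalE.
rewrite det_mulmx det_perm odd_permV mulrC -mulrA; congr (_ * (_ * _)).
by apply: eq_bigr => i _; rewrite !pvalE.
Qed.

End SkewDeterminant.

(** * The Pfaffian does not vanish at the standard skew form *)

Section SkewDeterminantNonzero.
Variables (F : numDomainType) (N m : nat).
Variables (e : 'I_m * bool -> 'I_N) (e' : 'I_N -> 'I_m * bool).
Hypotheses (eK : cancel e e') (e'K : cancel e' e).

(** The direct sum of blocks with rows (0, 1) and (-1, 0), one for each pair of indices. *)
Definition standard_skew : 'M[F]_N :=
  \matrix_(p, q) (if (e' p).1 == (e' q).1 then (e' q).2%:R - (e' p).2%:R else 0).

(** Such an [s] acts alike on the first and on the second members of the pairs. These two actions
    are conjugate under the swap [t] of the members, so their signs multiply to 1. *)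
Lemma even_pair_perm (s : 'S_N) (f : 'I_m -> 'I_m) :
  (forall i b, s (e (i, b)) = e (f i, b)) -> ~~ s.
Proof.
move=> sE; have f_inj : injective f.
  move=> i j eq_f; have /perm_inj /(can_inj eK) [//] : s (e (i, true)) = s (e (j, true)).
  by rewrite !sE eq_f.
(* [g] performs [s] on the members labelled [false] and fixes the others. *)
pose g p := if (e' p).2 then p else s p.
have g_inj : injective g.
  move=> p q; rewrite -(e'K p) -(e'K q) /g !eK.
  case: (e' p) (e' q) => [i []] [j []] //=; rewrite ?sE => /(can_inj eK) [] //.
  by move/f_inj ->.
pose t p := e ((e' p).1, ~~ (e' p).2).
have t_inj : injective t.
  by apply: (can_inj (g := t)) => p; rewrite /t eK /= negbK -surjective_pairing e'K.
have gE i b : perm g_inj (e (i, b)) = e (if b then i else f i, b).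
  by rewrite permE /g eK sE; case: b.
have tE i b : perm t_inj (e (i, b)) = e (i, ~~ b) by rewrite permE /t eK.
have tV i b : ((perm t_inj)^-1)%g (e (i, b)) = e (i, ~~ b).
  by apply: (@perm_inj _ (perm t_inj)); rewrite permKV tE negbK.
have -> : s = (perm g_inj * perm g_inj ^ perm t_inj)%g.
  apply/permP => p; rewrite -(e'K p); case: (e' p) => i b.
  by rewrite sE /conjg !permM gE tV gE tE negbK; case: b.
by rewrite odd_permM odd_permJ addbb.
Qed.

(** Induction on the number of pairs whose [false] member is sent to a [true] position. Exchanging
    the two members of such a pair before applying [s] changes both the sign of the permutation and
    that of the entry. When no such pair is left and the term is not 0, [s] permutes whole pairs,
    hence is even, and every factor is 1. *)
Lemma pfaffian_term_ge0 (s : 'S_N) :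
  0 <= (-1) ^+ s * \prod_i standard_skew (s (e (i, false))) (s (e (i, true))).
Proof.
have [k] := ubnP #|[set i | (e' (s (e (i, false)))).2]|.
elim: k s => // k IHk s; rewrite ltnS => le_k.
case: (pickP (fun i => (e' (s (e (i, false)))).2)) => [i0 si0 | s_half].
  pose t := tperm (e (i0, false)) (e (i0, true)).
  have tN i b : i != i0 -> t (e (i, b)) = e (i, b).
    by move=> ne_i; rewrite tpermD // (can_eq eK) xpair_eqE eq_sym (negPf ne_i).
  have [p0|nz_p] := eqVneq (standard_skew (s (e (i0, false))) (s (e (i0, true)))) 0.
    by rewrite (bigD1 i0) //= p0 mul0r mulr0.
  suff -> : (-1) ^+ s * \prod_i standard_skew (s (e (i, false))) (s (e (i, true)))
     = (-1) ^+ (t * s)%g *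
       \prod_i standard_skew ((t * s)%g (e (i, false))) ((t * s)%g (e (i, true))).
    apply: IHk; apply: leq_trans le_k; apply: proper_card; apply/properP; split.
      apply/subsetP => i; rewrite !inE permM.
      by have [->|ne_i] := eqVneq i i0; [rewrite si0 | rewrite tN].
    exists i0; rewrite !inE ?permM ?tpermL //.
    move: nz_p; rewrite mxE si0; case: ifP => _; last by rewrite eqxx.
    by case: (e' (s (e (i0, true)))).2; rewrite ?subrr ?eqxx.
  rewrite odd_mul_tperm (can_eq eK) xpair_eqE andbF addTb signrN mulNr.
  rewrite (bigD1 i0) //= [in RHS](bigD1 i0) //= -mulrN -mulNr; congr (_ * (_ * _)).
    by rewrite !permM tpermL tpermR !mxE eq_sym; case: ifP; rewrite ?opprB ?oppr0.
  by apply: eq_bigr => i ne_i; rewrite !permM !tN.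
have [i /eqP p0|nz_p] := pickP (fun i =>
    standard_skew (s (e (i, false))) (s (e (i, true))) == 0).
  by rewrite (bigD1 i) //= p0 mul0r mulr0.
have sE i : (e' (s (e (i, true)))).2 /\
    (e' (s (e (i, true)))).1 = (e' (s (e (i, false)))).1.
  move: (nz_p i); rewrite mxE s_half; case: ifP => [/eqP -> | _]; last by rewrite eqxx.
  by case: (e' (s (e (i, true)))).2; rewrite ?subrr ?eqxx.
have even_s : ~~ s.
  apply: (@even_pair_perm s (fun i => (e' (s (e (i, false)))).1)) => i b.
  apply: (can_inj e'K); rewrite eK [LHS]surjective_pairing; case: b.
    by case: (sE i) => -> ->.
  by rewrite s_half.
rewrite (negPf even_s) mul1r; apply: prodr_ge0 => i _.
by rewrite mxE s_half; case: (sE i) => -> ->; rewrite eqxx subr0 ler01.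
Qed.

Lemma pfaffian_standard_skew : pfaffian e standard_skew != 0.
Proof.
rewrite /pfaffian (bigD1 (1%g : 'S_N)) //= lt0r_neq0 // ltr_wpDr //.
  by apply: sumr_ge0 => s _; apply: pfaffian_term_ge0.
rewrite odd_perm1 mul1r big1 ?ltr01 // => i _.
by rewrite !perm1 mxE !eK eqxx subr0.
Qed.

End SkewDeterminantNonzero.
(** * The bordered characteristic polynomial *)

Lemma scalemx_inj (R : idomainType) (m n : nat) (a : R) :
  a != 0 -> injective (fun A : 'M[R]_(m, n) => a *: A).
Proof.
move=> nza A A' /matrixP eqA; apply/matrixP => i j.
by apply: (mulfI nza); have := eqA i j; rewrite !mxE.
Qed.

(** Schur complement with the adjugate in place of the inverse: multiplying on the right by a block
    triangular matrix clears the upper right block, and the extra factor [\det A] cancels. *)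
Lemma det_bordered (R : idomainType) (n : nat) (A : 'M[R]_n)
    (b : 'cV[R]_n) (c : 'rV[R]_n) : \det A != 0 ->
  \det (block_mx A b c 0) = - (c *m \adj A *m b) 0 0.
Proof.
move=> nzA; apply: (mulIf nzA).
have := det_mulmx (block_mx A b c 0)
  (block_mx 1%:M (- (\adj A *m b)) 0 (\det A)%:M).
rewrite mulmx_block !mulmx0 !mulmx1 !addr0 mul0mx addr0 !mulmxN !mulmxA.
rewrite mul_mx_adj mul_scalar_mx mul_mx_scalar addNr det_lblock det_ublock.
by rewrite det1 mul1r det_scalar expr1 [\det (- _)]det_mx11 mxE => <-; rewrite mulrC.
Qed.

Section BorderedCharPoly.
Variables (F : numFieldType) (n : nat).
Implicit Types (y : 'M[F]_n.+1) (w : 'rV[F]_n.+1).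

Local Notation pc := (map_mx polyC).

Lemma B_rec y k : B k.+1 y = y *m B k y - (p_coef k.+1 y)%:M.
Proof.
rewrite /B big_nat_recr //= subnn expr0 -scalemx1 opprD addrA; congr (_ - _).
rewrite mulmxBr -[y *m _]/(y * _) -exprS; congr (_ - _).
rewrite mulmx_sumr big_nat [RHS]big_nat; apply: eq_bigr => i /andP[_ le_ik].
by rewrite -scalemxAr -[y *m _]/(y * _) -exprS subSn.
Qed.

Lemma B0 y : B 0 y = 1%:M.
Proof. by rewrite /B big_geq // subr0. Qed.

(** At this index [B] is the characteristic polynomial evaluated at [y], so this is
    Cayley-Hamilton. *)
Lemma B_size y : B n.+1 y = 0.
Proof.
transitivity (horner_mx y (char_poly y)); last exact: Cayley_Hamilton.
have lead : (char_poly y)`_n.+1 = 1.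
  by have /monicP := char_poly_monic y; rewrite lead_coefE size_char_poly.
rewrite -[char_poly y]coefK poly_def size_char_poly rmorph_sum /= big_ord_recr.
rewrite horner_mxZ rmorphXn /= horner_mx_X lead scale1r addrC /B; congr (_ + _).
rewrite -sumrN big_add1 /= big_mkord (reindex_inj rev_ord_inj) /=.
apply: eq_bigr => i _; rewrite horner_mxZ rmorphXn /= horner_mx_X /p_coef.
by rewrite -scaleNr opprK !subSS subKn // -ltnS.
Qed.

(** Horner division of the characteristic polynomial by [X - y]: the matrices [B k y] are the
    coefficients of the quotient, and the remainder is [B n.+1 y = 0]. *)
Lemma char_poly_mx_mulB y :
  char_poly_mx y *m (\sum_(k < n.+1) 'X^(n - k) *: pc (B k y)) =
  (char_poly y)%:M.
Proof.
(* For [m] up to the size of [y], ['X^m - Q m] is formed from the leading [m + 1] coefficients of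
   the characteristic polynomial; the remainder [B m y] is its value at [y]. *)
pose Q m : {poly F} := \sum_(k < m) 'X^(m.-1 - k) * (p_coef k.+1 y)%:P.
have step m : char_poly_mx y *m (\sum_(k < m) 'X^(m.-1 - k) *: pc (B k y)) =
    ('X^m - Q m)%:M - pc (B m y).
  elim: m => [|m IHm]; first by rewrite /Q !big_ord0 mulmx0 B0 map_mx1 subr0 subrr.
  have -> : \sum_(k < m.+1) 'X^(m.+1.-1 - k) *: pc (B k y) =
      'X *: (\sum_(k < m) 'X^(m.-1 - k) *: pc (B k y)) + pc (B m y).
    rewrite big_ord_recr /= subnn expr0 scale1r scaler_sumr; congr (_ + _).
    apply: eq_bigr => k _; rewrite scalerA -exprS; congr ('X^_ *: _).
    by case: m k {IHm} => [[]|m k] //=; rewrite subSn // -ltnS.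
  have -> : Q m.+1 = 'X * Q m + (p_coef m.+1 y)%:P.
    rewrite /Q big_ord_recr /= subnn expr0 mul1r mulr_sumr; congr (_ + _).
    apply: eq_bigr => k _; rewrite mulrA -exprS; congr ('X^_ * _).
    by case: m k {IHm} => [[]|m k] //=; rewrite subSn // -ltnS.
  rewrite mulmxDr -scalemxAr IHm mulmxBl mul_scalar_mx -map_mxM B_rec.
  have -> : pc (y *m B m y - (p_coef m.+1 y)%:M) =
      pc (y *m B m y) - ((p_coef m.+1 y)%:P)%:M by rewrite map_mxB map_scalar_mx.
  move: (pc _) (pc _) => b a; apply/matrixP => i j; rewrite !mxE exprS.
  by case: (i == j); rewrite ?mulr1n ?mulr0n; ring.
rewrite (step n.+1) B_size map_mx0 subr0; congr (_%:M).
have lead : (char_poly y)`_n.+1 = 1.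
  by have /monicP := char_poly_monic y; rewrite lead_coefE size_char_poly.
rewrite -[RHS]coefK poly_def size_char_poly big_ord_recr /= lead scale1r addrC.
congr (_ + _); rewrite -sumrN (reindex_inj rev_ord_inj) /=.
apply: eq_bigr => k _; rewrite /p_coef mulrC -mulNr -polyCN opprK mul_polyC.
by rewrite !subSS subKn // -ltnS.
Qed.

Lemma char_poly_neq0 y : char_poly y != 0.
Proof. exact/monic_neq0/char_poly_monic. Qed.

Lemma adj_char_poly_mx y :
  \adj (char_poly_mx y) = \sum_(k < n.+1) 'X^(n - k) *: pc (B k y).
Proof.
apply: (scalemx_inj (char_poly_neq0 y)) => /=.
by rewrite -mul_mx_scalar -char_poly_mx_mulB mulmxA mul_adj_mx mul_scalar_mx.
Qed.

Definition Psi (lam : dualC F n.+1) : {poly F} :=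
  - (pc lam.2 *m \adj (char_poly_mx lam.1) *m (pc lam.2)^T) 0 0.

Lemma Psi_sum (lam : dualC F n.+1) :
  Psi lam = \sum_(k < n.+1) (- (lam.2 *m B k lam.1 *m lam.2^T) 0 0) *: 'X^(n - k).
Proof.
rewrite /Psi adj_char_poly_mx mulmx_sumr mulmx_suml summxE -sumrN.
apply: eq_bigr => k _; rewrite -scalemxAr -scalemxAl mxE map_trmx -!map_mxM.
by rewrite [X in _ * X]mxE scaleNr -mul_polyC mulrC.
Qed.

Lemma coef_Psi (lam : dualC F n.+1) k : (k <= n)%N ->
  (Psi lam)`_(n - k) = - (lam.2 *m B k lam.1 *m lam.2^T) 0 0.
Proof.
move=> le_kn; rewrite Psi_sum coef_sum (bigD1 (Ordinal (n:=n.+1) le_kn)) //=.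
rewrite coefZ coefXn eqxx mulr1 big1 ?addr0 // => i ne_i.
rewrite coefZ coefXn; case: eqP => [eq_nk|]; last by rewrite mulr0.
case/eqP: ne_i; apply: val_inj => /=.
by rewrite -(subKn le_kn) eq_nk subKn // -ltnS.
Qed.

Lemma psi_Psi (lam : dualC F n.+1) k : (k.*2 <= n)%N ->
  psi k lam = (Psi lam)`_(n - k.*2).
Proof. by move=> le_kn; rewrite coef_Psi. Qed.

Lemma size_Psi (lam : dualC F n.+1) : (size (Psi lam) <= n.+1)%N.
Proof.
rewrite Psi_sum; apply: (leq_trans (size_sum _ _ _)); apply/bigmax_leqP => i _.
by apply: leq_trans (size_scale_leq _ _) _; rewrite size_polyXn ltnS leq_subr.
Qed.

Lemma Psi_bordered (lam : dualC F n.+1) :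
  Psi lam = \det (block_mx (char_poly_mx lam.1) (pc lam.2)^T (pc lam.2) 0).
Proof. by rewrite det_bordered // char_poly_neq0. Qed.

Lemma Psi_coef_polynomial j : polynomial_function (fun lam => (Psi lam)`_j).
Proof.
apply/polynomial_functionE; move: j.
apply: (pgenerated_ext (fun lam => esym (Psi_bordered lam))).
apply: pgenerated_det => i j; rewrite -(splitK i) -(splitK j).
case: (split i) (split j) => [i1|i2] [j1|j2] /=.
- apply: (pgenerated_ext (f := fun lam : dualC F n.+1 =>
    'X *+ (i1 == j1) - ((lam.1 : 'M_n.+1) i1 j1)%:P)).
    by move=> lam; rewrite block_mxEul !mxE.
  apply: pgeneratedD; first exact: pgenerated_const.
  exact/pgeneratedN/pgeneratedC/polynomial_y.
- apply: (pgenerated_ext (f := fun lam : dualC F n.+1 => (lam.2 j2 i1)%:P)).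
    by move=> lam; rewrite block_mxEur !mxE.
  exact/pgeneratedC/polynomial_w.
- apply: (pgenerated_ext (f := fun lam : dualC F n.+1 => (lam.2 i2 j1)%:P)).
    by move=> lam; rewrite block_mxEdl !mxE.
  exact/pgeneratedC/polynomial_w.
apply: (pgenerated_ext (f := fun _ => 0)).
  by move=> lam; rewrite block_mxEdr mxE.
exact: pgenerated_const.
Qed.

Lemma psi_polynomial k : (k.*2 <= n)%N ->
  polynomial_function (fun lam : dualC F n.+1 => psi k lam).
Proof.
move=> le_kn; apply/polynomial_functionE.
apply: (generated_ext (fun lam => esym (psi_Psi lam le_kn))).
exact: Psi_coef_polynomial.
Qed.

Lemma is_coadE (h : IO F n.+1) lam mu : is_coad h lam mu -> mu = coad h lam.
Proof. by move=> mu_h; apply: pairing_inj => X; rewrite mu_h coadP. Qed.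

Lemma orth_det_sqr (g : orth F n.+1) : \det (g : 'M_n.+1) ^+ 2 = 1.
Proof.
by rewrite expr2 -{1}det_tr -det_mulmx (eqP (orth_eq g)) det1.
Qed.

(** The action of [(g, u)] multiplies the bordered matrix on both sides by block triangular matrices
    of determinant [\det g], whose square is 1. *)
Lemma Psi_coad (h : IO F n.+1) lam : Psi (coad h lam) = Psi lam.
Proof.
rewrite !Psi_bordered; case: h lam => g u [y w] /=.
pose G := pc (g : 'M_n.+1); pose W := pc w; pose U := pc u.
(* [U] has opposite signs in [K] and [K'], because the two borders have equal signs while the term
   added to [y] is skew. *)
pose K := block_mx G (- U) 0 (1%:M : 'M_1).
pose K' := block_mx G^T 0 U^T (1%:M : 'M_1).
have GV : G *m G^T = 1%:M.
  by rewrite map_trmx -map_mxM -orth_inv mulmxV ?orth_unit // map_mx1.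
have WE : pc (w *m (g : 'M_n.+1)^T) = W *m G^T by rewrite map_mxM -map_trmx.
have -> : block_mx (char_poly_mx ((g : 'M_n.+1) *m y *m invmx g +
      (u *m (w *m invmx g) - (u *m (w *m invmx g))^T)))
      (pc (w *m invmx g))^T (pc (w *m invmx g)) 0 =
    K *m block_mx (char_poly_mx y) W^T W 0 *m K'.
  rewrite orth_inv /K /K' !mulmx_block !mulmx1 !mul1mx !mul0mx !mulmx0 !addr0 !add0r.
  rewrite WE; congr block_mx; [|by rewrite trmx_mul trmxK|by rewrite mul0mx addr0].
  rewrite /char_poly_mx map_mxD map_mxB !map_mxM -!map_trmx !map_mxM -map_trmx.
  rewrite -/G -/W -/U trmx_mul trmx_mul trmxK mulmxDl mulmxBr mulmxBl mul_mx_scalar.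
  rewrite -scalemxAl GV scalemx1 !mulNmx ?mulmxA opprD opprB addrA -!addrA.
  by congr (_ + (_ + _)); rewrite addrC.
have detg : \det G ^+ 2 = 1.
  by rewrite det_map_mx -rmorphXn /= orth_det_sqr.
rewrite !det_mulmx !det_ublock !det_lblock !det1 !mulr1 det_tr.
by rewrite mulrAC -expr2 detg mul1r.
Qed.

Lemma psi_coad (h : IO F n.+1) lam k : (k.*2 <= n)%N ->
  psi k (coad h lam) = psi k lam.
Proof. by move=> le_kn; rewrite !psi_Psi // Psi_coad. Qed.

(* z is adj(X - y) w^T, by cancellation of the characteristic polynomial. *)
Lemma Psi_solution (lam : dualC F n.+1) (z : 'cV[{poly F}]_n.+1) :
  char_poly_mx lam.1 *m z = char_poly lam.1 *: (pc lam.2)^T ->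
  Psi lam = - (pc lam.2 *m z) 0 0.
Proof.
move=> Ez; rewrite /Psi -mulmxA; congr (- (_ *m _) 0 0).
apply: (scalemx_inj (char_poly_neq0 lam.1)) => /=.
by rewrite scalemxAr -Ez mulmxA mul_adj_mx mul_scalar_mx.
Qed.

(** Since [y] is skew, it also kills the transpose of [w]. On that vector [X - y] is multiplication
    by [X], and the adjugate of [X - y] then produces the characteristic polynomial. *)
Lemma Psi_kernel (lam : dualC F n.+1) : lam.2 *m lam.1 = 0 ->
  'X * Psi lam = (- (lam.2 *m lam.2^T) 0 0) *: char_poly lam.1.
Proof.
case: lam => y w /= wy0; rewrite /Psi /= mulrN.
have yw0 : (y : 'M_n.+1) *m w^T = 0.
  by rewrite -[y : 'M_n.+1]trmxK -trmx_mul (eqP (so_skew y)) mulmxN wy0 oppr0 trmx0.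
have Xw : 'X *: (pc w)^T = char_poly_mx y *m (pc w)^T.
  by rewrite mulmxBl mul_scalar_mx map_trmx -map_mxM yw0 map_mx0 subr0.
rewrite -[- (_ * _)]mulrN -[LHS]/('X * _) mulrN.
have -> : 'X * (pc w *m \adj (char_poly_mx y) *m (pc w)^T) 0 0 =
    ('X *: (pc w *m \adj (char_poly_mx y) *m (pc w)^T)) 0 0 by rewrite [RHS]mxE.
rewrite scalemxAr Xw mulmxA -[_ *m \adj _ *m _]mulmxA mul_adj_mx mul_mx_scalar.
by rewrite -scalemxAl mxE map_trmx -map_mxM [X in _ * X]mxE scaleNr -mul_polyC mulrC.
Qed.

End BorderedCharPoly.

(** * Odd dimension: evenness of [Psi], the semi-invariant [Phi] and its values on h *)

Lemma ltn_pair (m : nat) (k : 'I_m) (b : bool) : (k.*2 + b < m.*2)%N.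
Proof.
apply: (@leq_trans k.+1.*2); last by rewrite leq_double.
by rewrite doubleS -addn2 -addnS leq_add2l; case: b.
Qed.

Section OddDimension.
Variables (F : numFieldType) (l : nat).
Local Notation n := l.*2.
Local Notation dual := (dualC F n.+1).
Local Notation pc := (map_mx polyC).
Implicit Types lam : dual.

(* y is skew, so the bordered matrix at -X is minus the transpose of the one at
   X, up to the sign of one row. *)
Lemma Psi_even lam : Psi lam \Po (- 'X) = Psi lam.
Proof.
rewrite Psi_bordered -det_map_mx map_block_mx.
case: lam => y w /=.
have compC (A : 'M[F]_(1, n.+1)) :
    map_mx (comp_poly (- 'X)) (pc A) = pc A.
  by apply/matrixP => i j; rewrite !mxE comp_polyC.
have -> : map_mx (comp_poly (- 'X)) (char_poly_mx y) = - (char_poly_mx y)^T.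
  apply/matrixP => i j; rewrite !mxE.
  have /eqP/matrixP/(_ i j) := so_skew y; rewrite !mxE => ->.
  rewrite raddfB raddfMn /= comp_polyC comp_polyX polyCN opprK opprD.
  by rewrite eq_sym mulNrn.
rewrite -map_trmx compC map_mx0.
have -> : block_mx (- (char_poly_mx y)^T) (pc w)^T (pc w) (0 : 'M_1) =
    block_mx (- 1%:M) 0 0 1%:M *m
    (block_mx (char_poly_mx y) (pc w)^T (pc w) 0)^T *m
    block_mx 1%:M 0 0 (- 1%:M).
  rewrite tr_block_mx !mulmx_block !mulmx0 !mul0mx !addr0 !add0r !mulmx1 !mul1mx.
  by rewrite !mulNmx !mulmxN !mul1mx !mulmx1 ?opprK trmxK trmx0 ?oppr0 ?mulmx0 ?oppr0.
(* The two sign matrices have determinants [(-1)^(2l+1)] and -1, with product 1. *)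
rewrite !det_mulmx !det_lblock !det1 det_tr mulr1 mul1r.
rewrite -!scaleN1r !detZ !det1 !mulr1 expr1 mulrAC -exprSr.
by rewrite scaleN1r -signr_odd /= odd_double mul1r.
Qed.

Definition Psi2 lam := even_poly (Psi lam).

(** Substituting [- 'X] negates the odd half of [Psi], which is therefore 0. *)
Lemma Psi_Psi2 lam : Psi lam = Psi2 lam \Po 'X^2.
Proof.
suff odd0 : odd_poly (Psi lam) = 0.
  by rewrite -[LHS]poly_even_odd odd0 comp_poly0 mul0r addr0.
have sqrNX : 'X^2 \Po (- 'X) = 'X^2 :> {poly F}.
  by rewrite rmorphXn /= comp_polyX sqrrN.
have := Psi_even lam; rewrite -{1 2}[Psi lam]poly_even_odd comp_polyD comp_polyM.
rewrite -!comp_polyA sqrNX comp_polyX mulrN => /addrI /eqP.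
rewrite eq_sym -addr_eq0 -mulrDl mulf_eq0 polyX_eq0 orbF -mulr2n -mulr_natr mulf_eq0.
rewrite -[2%:R](rmorph_nat polyC) polyC_eq0 pnatr_eq0 orbF => /eqP odd0.
apply/polyP => i; have := congr1 (fun p : {poly F} => p`_(i * 2)) odd0.
by rewrite /= coef_comp_poly_Xn // dvdn_mull // mulnK // !coef0.
Qed.

Lemma coef_Psi2 lam k : (k <= l)%N -> (Psi2 lam)`_(l - k) = psi k lam.
Proof.
by move=> le_kl; rewrite coef_even_poly psi_Psi ?leq_double // doubleB.
Qed.

Lemma size_Psi2 lam : (size (Psi2 lam) <= l.+1)%N.
Proof.
apply/leq_sizeP => j lt_lj; rewrite coef_even_poly nth_default //.
by apply: leq_trans (size_Psi lam) _; rewrite ltn_double.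
Qed.

Lemma psi0E lam : psi 0 lam = - (lam.2 *m lam.2^T) 0 0.
Proof. by rewrite /psi B0 mulmx1. Qed.

(** The rows [0, ..., 2l + 1] of the bordered matrix are grouped as [2k, 2k + 1]. The last pair
    joins the last row of [y] to the border, so on h it carries the coefficient [b]. *)
Definition pair_index (p : 'I_l.+1 * bool) : 'I_(n.+1 + 1) :=
  inord (p.1.*2 + p.2).
Definition index_pair (p : 'I_(n.+1 + 1)) : 'I_l.+1 * bool :=
  (inord p./2, odd p).

Lemma pair_index_val p : pair_index p = (p.1.*2 + p.2)%N :> nat.
Proof.
case: p => k b; rewrite /= /pair_index.
by rewrite inordK // -[X in (_ < X)%N]/(n.+1 + 1)%N addn1 -(doubleS l) ltn_pair.
Qed.

Lemma pair_indexK : cancel pair_index index_pair.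
Proof.
case=> k b; rewrite /index_pair pair_index_val /=; congr pair; last first.
  by rewrite oddD odd_double; case: b.
by apply: val_inj; rewrite /= addnC half_bit_double inordK.
Qed.

Lemma index_pairK : cancel index_pair pair_index.
Proof.
move=> p; apply: val_inj; rewrite /= pair_index_val /= inordK.
  by rewrite addnC odd_double_half.
have := ltn_ord p; rewrite [X in (_ < X)%N]addn1 -(doubleS l) -{1}(odd_double_half p).
by rewrite -[X in (_ < X)%N]add0n; case: odd; rewrite ?add1n ?add0n ?ltn_double // ltn_Sdouble.
Qed.

Definition bordered_skew lam : 'M[F]_(n.+1 + 1) :=
  block_mx lam.1 lam.2^T (- lam.2) 0.

Definition pf lam := pfaffian pair_index (bordered_skew lam).

Lemma pf_coad (h : IO F n.+1) lam :
  pf (coad h lam) = \det (h.1 : 'M_n.+1) * pf lam.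
Proof.
case: h lam => g u [y w] /=.
pose K := block_mx (g : 'M_n.+1) (- u) 0 (1%:M : 'M_1).
have detK : \det K = \det (g : 'M_n.+1) by rewrite det_ublock det1 mulr1.
rewrite /pf -detK -(pfaffian_congr pair_indexK index_pairK); congr pfaffian.
rewrite /K /bordered_skew /= orth_inv tr_block_mx !mulmx_block !trmx0 !trmx1.
rewrite !mulmx1 !mul1mx !mul0mx !mulmx0 !addr0 !add0r.
congr block_mx; rewrite ?trmx_mul ?trmxK ?mulNmx ?mul0mx ?addr0 //.
rewrite mulmxN opprK mulmxDl raddfN /= mulmxN -!mulmxA -addrA.
by congr (_ + (_ - _)).
Qed.

Lemma pf_polynomial : polynomial_function pf.
Proof.
apply/polynomial_functionE; apply: generated_sum => s _; apply: generatedM.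
  exact: generated_const.
apply: generated_prod => k _.
move: (s _) (s _) => j i; rewrite -(splitK i) -(splitK j).
case: (split i) (split j) => [i1|i2] [j1|j2] /=.
- apply: (generated_ext (f := fun lam : dual => (lam.1 : 'M_n.+1) i1 j1)).
    by move=> lam; rewrite /bordered_skew block_mxEul.
  exact: polynomial_y.
- apply: (generated_ext (f := fun lam : dual => lam.2 j2 i1)).
    by move=> lam; rewrite /bordered_skew block_mxEur mxE.
  exact: polynomial_w.
- apply: (generated_ext (f := fun lam : dual => - lam.2 i2 j1)).
    by move=> lam; rewrite /bordered_skew block_mxEdl mxE.
  exact/generatedN/polynomial_w.
apply: (generated_ext (f := fun _ => 0)); last exact: generated_const.
by move=> lam; rewrite /bordered_skew block_mxEdr mxE.
Qed.

Definition block_index (k : 'I_l) (c : bool) : 'I_n.+1 := inord (k.*2 + c).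

Lemma block_index_val k c : block_index k c = (k.*2 + c)%N :> nat.
Proof. by rewrite inordK //; apply/ltnW/ltn_pair. Qed.

Lemma block_index_eq k k' c c' :
  (block_index k c == block_index k' c') = (k == k') && (c == c').
Proof.
rewrite -val_eqE /= !block_index_val; apply/eqP/andP => [eq_k|[/eqP-> /eqP->] //].
have := congr1 odd eq_k; rewrite !oddD !odd_double !oddb /= => ->.
have := congr1 half eq_k; rewrite ![(_ + nat_of_bool _)%N]addnC !half_bit_double.
by move=> /ord_inj ->.
Qed.

Lemma block_index_max k c : (block_index k c == ord_max) = false.
Proof. by rewrite -val_eqE /= block_index_val ltn_eqF // ltn_pair. Qed.

Lemma h_mxE a : h_mx a = \sum_(k < l) a k *:
  (delta_mx (block_index k false) (block_index k true) -
   delta_mx (block_index k true) (block_index k false)) :> 'M[F]_n.+1.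
Proof. by apply: eq_bigr => k _; rewrite /block_index addn0 addn1. Qed.

Lemma h_mx_row (a : 'I_l -> F) k c :
  delta_mx 0 (block_index k c) *m h_mx a =
  (if c then - a k else a k) *: delta_mx 0 (block_index k (~~ c)) :> 'rV_n.+1.
Proof.
rewrite h_mxE mulmx_sumr (bigD1 k) //= big1 => [|j ne_jk].
  rewrite addr0 -scalemxAr mulmxBr !mul_delta_mx_cond !block_index_eq !eqxx /=.
  by case: c; rewrite ?mulr1n ?mulr0n ?subr0 ?sub0r ?scalerN ?scaleNr.
rewrite -scalemxAr mulmxBr !mul_delta_mx_cond !block_index_eq eq_sym (negPf ne_jk).
by rewrite !mulr0n subrr scaler0.
Qed.

Lemma h_mx_last (a : 'I_l -> F) : delta_mx 0 ord_max *m h_mx a = 0 :> 'rV_n.+1.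
Proof.
rewrite h_mxE mulmx_sumr big1 // => j _; rewrite -scalemxAr mulmxBr.
by rewrite !mul_delta_mx_cond ![ord_max == _]eq_sym !block_index_max subrr scaler0.
Qed.

Definition h_diag (a : 'I_l -> F) (b : F) (k : 'I_l.+1) : F :=
  oapp a b (unlift ord_max k).

Lemma pair_index_lift k c :
  pair_index (lift ord_max k, c) = lshift 1 (block_index k c).
Proof.
by apply: val_inj => /=; rewrite pair_index_val /= block_index_val /bump leqNgt ltn_ord.
Qed.

Lemma pair_index_last : pair_index (ord_max, false) = lshift 1 ord_max.
Proof. by apply: val_inj => /=; rewrite pair_index_val /= addn0. Qed.

Lemma pair_index_border : pair_index (ord_max, true) = rshift n.+1 ord0.
Proof. by apply: val_inj => /=; rewrite pair_index_val /= addn1 addn0. Qed.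

(** Scaling one member of each pair by the parameter attached to that pair is a congruence of the
    standard form, so the Pfaffian on h can be read off from [\det d]. *)
Lemma bordered_skew_h a b :
  let d := diag_mx (\row_p (if (index_pair p).2 then 1 else
                            h_diag a b (index_pair p).1)) in
  bordered_skew (h_point a b) = d *m standard_skew F index_pair *m d^T.
Proof.
pose dd p := if (index_pair p).2 then 1 else h_diag a b (index_pair p).1.
move=> d; apply/matrixP => p q.
have -> : (d *m standard_skew F index_pair *m d^T) p q =
    dd p * (if (index_pair p).1 == (index_pair q).1
            then (index_pair q).2%:R - (index_pair p).2%:R else 0) * dd q.
  by rewrite tr_diag_mx mul_mx_diag mul_diag_mx !mxE.
rewrite /dd {dd d}.
have h_row i j : (h_mx a : 'M_n.+1) i j = (delta_mx 0 i *m h_mx a : 'rV_n.+1) 0 j.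
  by rewrite -rowE mxE.
rewrite -(index_pairK p) -(index_pairK q) !pair_indexK.
case: (index_pair p) (index_pair q) => [k c] [k' c'] /=; rewrite /h_diag.
case: (unliftP ord_max k) (unliftP ord_max k') => [{}k|] -> [{}k'|] -> /=.
- rewrite !pair_index_lift /bordered_skew block_mxEul h_row h_mx_row !mxE /=.
  rewrite block_index_eq (inj_eq lift_inj) eq_sym.
  case: eqP => [->|_] /=; last by rewrite !(mulr0, mul0r).
  by case: c c' => [] [] /=; rewrite ?subrr ?subr0 ?sub0r ?mulr1 ?mul1r ?mulr0 ?mul0r ?mulN1r ?mulr1.
- rewrite [lift _ _ == _]eq_sym (negPf (neq_lift _ _)) mulr0 mul0r pair_index_lift.
  case: c'.
    by rewrite pair_index_border /bordered_skew block_mxEur !mxE block_index_max mulr0.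
  rewrite pair_index_last /bordered_skew block_mxEul h_row h_mx_row !mxE /=.
  by rewrite eq_sym block_index_max mulr0.
- rewrite (negPf (neq_lift _ _)) mulr0 mul0r pair_index_lift; case: c.
    rewrite pair_index_border /bordered_skew block_mxEdl !mxE block_index_max.
    by rewrite mulr0 oppr0.
  rewrite pair_index_last /bordered_skew block_mxEul h_row h_mx_last.
  by rewrite mxE.
rewrite eqxx; case: c c' => [] [] /=.
- by rewrite pair_index_border /bordered_skew block_mxEdr !mxE subrr mulr0 mul0r.
- rewrite pair_index_border pair_index_last /bordered_skew block_mxEdl !mxE !eqxx.
  by rewrite mulr1 sub0r mul1r mulN1r.
- rewrite pair_index_border pair_index_last /bordered_skew block_mxEur !mxE !eqxx.
  by rewrite subr0 !mulr1.
by rewrite pair_index_last /bordered_skew block_mxEul h_row h_mx_last mxE subrr mulr0 mul0r.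
Qed.

Definition Phi lam := pf lam / pfaffian pair_index (standard_skew F index_pair).

Lemma Phi_coad (h : IO F n.+1) lam :
  Phi (coad h lam) = \det (h.1 : 'M_n.+1) * Phi lam.
Proof. by rewrite /Phi pf_coad mulrA. Qed.

Lemma Phi_polynomial : polynomial_function Phi.
Proof.
apply/polynomial_functionE.
by apply: generatedM; [apply: pf_polynomial | apply: generated_const].
Qed.

Lemma Phi_h_point : restricts_to_phi Phi.
Proof.
move=> a b; rewrite /Phi /pf bordered_skew_h.
rewrite (pfaffian_congr pair_indexK index_pairK) mulfK; last first.
  exact: (pfaffian_standard_skew F pair_indexK index_pairK).
rewrite det_diag (prod_pairs pair_indexK index_pairK) mulrC.
under eq_bigr => k _ do rewrite !mxE !pair_indexK /= mul1r.
rewrite (bigD1_ord ord_max) //= mulrC /h_diag unlift_none; congr (_ * _).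
by apply: eq_bigr => k _; rewrite liftK.
Qed.

Lemma Phi_Yc : Yc Phi.
Proof.
split=> [|h lam mu det_h /is_coadE ->]; first exact: Phi_polynomial.
by rewrite Phi_coad det_h mul1r.
Qed.

Lemma psi_J k : (k <= l)%N -> J (fun lam : dual => psi k lam).
Proof.
move=> le_kl; split=> [|h lam mu /is_coadE ->].
  by apply: psi_polynomial; rewrite leq_double.
by apply: psi_coad; rewrite leq_double.
Qed.

Lemma h_point_kernel (a : 'I_l -> F) b : (h_point a b).2 *m h_mx a = 0.
Proof. by rewrite -scalemxAl h_mx_last scaler0. Qed.

Lemma h_point_norm (a : 'I_l -> F) b :
  ((h_point a b).2 *m (h_point a b).2^T) 0 0 = b ^+ 2.
Proof.
rewrite /= linearZ /= trmx_delta -scalemxAr -scalemxAl mul_delta_mx.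
by rewrite !mxE !eqxx mulr1.
Qed.

End OddDimension.
(** * Generic orbits *)

Lemma row_diag_mx_mul (R : pzSemiRingType) (m n : nat) (d : 'rV[R]_m)
    (A : 'M[R]_(m, n)) i : row i (diag_mx d *m A) = d 0 i *: row i A.
Proof. by apply/rowP => j; rewrite mul_diag_mx !mxE. Qed.

Section Eigenvalues.
Variables (F : numClosedFieldType) (n : nat).
Implicit Types (A : 'M[F]_n.+1) (v : 'rV[F]_n.+1).

Lemma eigenvector_horner A v r q :
  v *m A = r *: v -> v *m horner_mx A q = q.[r] *: v.
Proof.
move=> vA; elim/poly_ind: q => [|q c IHq].
  by rewrite rmorph0 horner0 mulmx0 scale0r.
rewrite rmorphD rmorphM /= horner_mx_X horner_mx_C hornerMXaddC mulmxDr.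
rewrite -[_ * A]/(_ *m A) mulmxA IHq -scalemxAl vA scalerA mul_mx_scalar.
by rewrite -scalerDl.
Qed.

Definition distinct_eigenvalues A (s : seq F) :=
  [/\ uniq s, size s = n.+1 & forall x, x \in s -> eigenvalue A x].

Lemma char_poly_distinct A s :
  distinct_eigenvalues A s -> char_poly A = \prod_(x <- s) ('X - x%:P).
Proof.
case=> uniq_s size_s eig_s.
have /monicP lead := char_poly_monic A.
rewrite -[RHS]scale1r -lead; apply: all_roots_prod_XsubC.
- by rewrite size_char_poly size_s.
- by apply/allP => x /eig_s; rewrite eigenvalue_root_char.
by rewrite uniq_rootsE.
Qed.

(** Turns simplicity of the spectrum into a polynomial condition: up to sign the determinant is the
    discriminant of the characteristic polynomial. It is nonzero exactly when [char_poly A] and its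
    derivative have no common root. *)
Lemma distinct_eigenvaluesP A :
  (exists s, distinct_eigenvalues A s) <->
  \det (horner_mx A (char_poly A)^`()) != 0.
Proof.
split=> [[s eig_s]|det0].
  have : separable_poly (char_poly A).
    rewrite (char_poly_distinct eig_s) separable_prod_XsubC.
    by case: eig_s.
  rewrite separable_poly.unlock => /Bezout_eq1_coprimepP [[u v]] /= uv1.
  apply/det0P => [[x nz_x x0]]; case/eqP: nz_x.
  have := congr1 (fun p => x *m horner_mx A p) uv1.
  rewrite rmorphD !rmorphM /= Cayley_Hamilton mulr0 add0r rmorph1 mulmx1.
  by rewrite (comm_horner_mx2 A v) -[_ * _]/(_ *m _) mulmxA x0 mul0mx.
have [s sE] := closed_field_poly_normal (char_poly A).
move: sE; have /monicP -> := char_poly_monic A; rewrite scale1r => sE.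
exists s; split.
- rewrite -separable_prod_XsubC -sE; apply: contraNT det0.
  rewrite separable_poly.unlock => /closed_rootP [x].
  rewrite root_gcd => /andP[]; rewrite -eigenvalue_root_char => /eigenvalueP[v vA nz_v].
  move=> /rootP r0; apply/det0P; exists v => //.
  by rewrite (eigenvector_horner _ vA) r0 scale0r.
- by apply: succn_inj; rewrite -(size_char_poly A) sE size_prod_XsubC.
by move=> x s_x; rewrite eigenvalue_root_char sE root_prod_XsubC.
Qed.

(** The rows are left eigenvectors in the order of [s]. Taking the given [w] at the eigenvalue 0 is
    what later lets the conjugating matrix carry one such vector to the other. *)
Lemma eigenbasis A s w : distinct_eigenvalues A s -> w *m A = 0 -> w != 0 ->
  exists2 P : 'M[F]_n.+1, P \in unitmx &
    P *m A = diag_mx (\row_i s`_i) *m P /\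
    (forall i : 'I_n.+1, s`_i = 0 -> row i P = w).
Proof.
case=> uniq_s size_s eig_s wA0 nz_w.
have s_i (i : 'I_n.+1) : s`_i \in s by rewrite mem_nth ?size_s.
have vex (i : 'I_n.+1) : exists x : 'rV[F]_n.+1,
    [/\ x *m A = s`_i *: x, x != 0 & s`_i = 0 -> x = w].
  have [s0|nz_s] := eqVneq s`_i 0; first by exists w; rewrite s0 scale0r.
  have /eigenvalueP[x xA nz_x] := eig_s _ (s_i i).
  by exists x; split=> // s0; rewrite s0 eqxx in nz_s.
have [v vP] := fin_all_exists vex.
exists (\matrix_j v j); last first.
  split=> [|i s0]; last by rewrite rowK; case: (vP i) => _ _ ->.
  apply/row_matrixP => i; rewrite row_mul row_diag_mx_mul rowK.
  by case: (vP i) => -> _ _; rewrite mxE.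
rewrite unitmxE unitfE; apply/det0P => [[u nz_u u0]]; case/eqP: nz_u.
apply/rowP => i; rewrite mxE.
(* [q] at [A] annihilates every chosen eigenvector except the one at [i]; this gives linear
   independence. *)
pose q := \prod_(j < n.+1 | j != i) ('X - (s`_j)%:P).
have : u *m (\matrix_j v j) *m horner_mx A q = 0 by rewrite u0 mul0mx.
rewrite (mulmx_sum_row u) mulmx_suml (bigD1 i) //= big1 ?addr0 => [|j ne_ji].
  rewrite rowK -scalemxAl; case: (vP i) => vA nz_v _.
  rewrite (eigenvector_horner _ vA) scalerA => /eqP.
  rewrite scaler_eq0 (negPf nz_v) orbF mulf_eq0 => /orP[/eqP //|].
  rewrite horner_prod => /prodf_eq0 [j ne_ji]; rewrite hornerXsubC subr_eq0.
  by rewrite nth_uniq ?size_s // eq_sym => /eqP eq_ji; case/eqP: ne_ji; apply: val_inj.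
rewrite rowK -scalemxAl; case: (vP j) => vA _ _.
rewrite (eigenvector_horner _ vA) horner_prod (bigD1 j) //= hornerXsubC subrr.
by rewrite mul0r scale0r scaler0.
Qed.

(* Scaling the rows of one eigenbasis turns its Gram matrix G into the other one:
   since y is skew, G pairs the eigenvalue x with -x only. *)
Lemma orth_conj_distinct (y y' : so F n.+1) (w w' : 'rV[F]_n.+1) s :
  distinct_eigenvalues y s -> distinct_eigenvalues y' s ->
  w *m y = 0 -> w' *m y' = 0 -> w *m w^T = w' *m w'^T -> (w *m w^T) 0 0 != 0 ->
  exists g : orth F n.+1,
    (g : 'M_n.+1) *m y *m (g : 'M_n.+1)^T = y' /\ w *m (g : 'M_n.+1)^T = w'.
Proof.
move=> eig_s eig_s' wy0 wy0' eq_ww nz_ww.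
have [uniq_s size_s eig] := eig_s.
have nz_w : w != 0 by apply: contraNneq nz_ww => ->; rewrite mul0mx mxE.
have nz_w' : w' != 0.
  by apply: contraNneq nz_ww => w0; rewrite eq_ww w0 mul0mx mxE.
have [P uP [PA P0]] := eigenbasis eig_s wy0 nz_w.
have [P' uP' [PA' P0']] := eigenbasis eig_s' wy0' nz_w'.
pose d : 'rV[F]_n.+1 := \row_i s`_i.
(* Row [i] of a Gram matrix can be nonzero only at the opposite eigenvalue, and there it is nonzero
   because the matrix is invertible. *)
have gram (z : so F n.+1) (Q : 'M[F]_n.+1) : Q \in unitmx ->
    Q *m z = diag_mx d *m Q -> forall i j : 'I_n.+1,
    (s`_j != - s`_i -> (Q *m Q^T) i j = 0) /\
    (s`_j = - s`_i -> (Q *m Q^T) i j != 0 /\ \sum_k (Q *m Q^T) i k = (Q *m Q^T) i j).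
  move=> uQ Qz.
  have off (i j : 'I_n.+1) : s`_j != - s`_i -> (Q *m Q^T) i j = 0.
    have : Q *m Q^T *m diag_mx d = - (diag_mx d *m (Q *m Q^T)).
      rewrite mulmxA -Qz -{1}(tr_diag_mx d) -!mulmxA -trmx_mul -Qz trmx_mul.
      by rewrite (eqP (so_skew z)) mulNmx mulmxN.
    move/matrixP/(_ i j); rewrite mul_mx_diag mul_diag_mx !mxE.
    move=> /eqP; rewrite -addr_eq0 mulrC -mulrDl mulf_eq0 addr_eq0.
    by case/orP => [->|/eqP] //.
  move=> i j; split=> [|eq_ji]; first exact: off.
  have rest k : k != j -> (Q *m Q^T) i k = 0.
    move=> ne_kj; apply: off; rewrite -eq_ji nth_uniq ?size_s //.
  split; last by rewrite (bigD1 j) //= big1 ?addr0.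
  apply/eqP => G0.
  have : \det (Q *m Q^T) == 0.
    apply/det0P; exists (delta_mx 0 i).
      by apply/eqP => /matrixP/(_ 0 i)/eqP; rewrite !mxE !eqxx oner_eq0.
    apply/rowP => k; rewrite -rowE !mxE; have [->|/rest] := eqVneq k j.
      by move: G0; rewrite mxE.
    by rewrite mxE.
  by rewrite det_mulmx det_tr mulf_eq0 orbb -[_ == 0]negbK -unitfE -unitmxE uQ.
pose G := P *m P^T; pose G' := P' *m P'^T.
(* The row sum picks out the one nonzero entry without naming its index. The ratio is the same at
   two opposite eigenvalues, so their scalings multiply to exactly this ratio. *)
pose c i := sqrtC ((\sum_k G' i k) / (\sum_k G i k)).
pose S := diag_mx (\row_i c i).
have Gsym i j : G i j = G j i by rewrite -[in LHS](trmxK G) mxE trmx_mul trmxK.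
have Gsym' i j : G' i j = G' j i by rewrite -[in LHS](trmxK G') mxE trmx_mul trmxK.
have SGS : S *m G *m S = G'.
  apply/matrixP => i j.
  have -> : (S *m G *m S) i j = c i * G i j * c j.
    by rewrite mul_mx_diag mul_diag_mx [LHS]mxE [X in X * _]mxE ![(\row__ _) _ _]mxE.
  have [offG onG] := gram y P uP PA i j; have [offG' onG'] := gram y' P' uP' PA' i j.
  have [eq_ji|ne_ji] := eqVneq s`_j (- s`_i); last first.
    by rewrite /G /G' offG // offG' // mulr0 mul0r.
  have eq_ij : s`_i = - s`_j by rewrite eq_ji opprK.
  have [nzG sumG] := onG eq_ji; have [_ sumG'] := onG' eq_ji.
  have [_ sumGj] := (gram y P uP PA j i).2 eq_ij.
  have [_ sumGj'] := (gram y' P' uP' PA' j i).2 eq_ij.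
  have -> : c j = c i.
    by rewrite /c /G /G' sumG sumG' sumGj sumGj' -/G -/G' Gsym Gsym'.
  by rewrite mulrAC -expr2 sqrtCK /G /G' sumG sumG' divfK.
(* [g] matches the rescaled first eigenbasis with the second one; [SGS] makes it orthogonal. *)
have [g gE] : exists g, P' *m g = S *m P.
  by exists (invmx P' *m (S *m P)); rewrite mulKVmx.
have ggT : g *m g^T = 1%:M.
  apply: (can_inj (mulKmx uP')); rewrite mulmxA gE.
  apply: (can_inj (mulmxK (_ : P'^T \in unitmx))); first by rewrite unitmx_tr.
  rewrite -[LHS]mulmxA -trmx_mul gE trmx_mul tr_diag_mx mulmx1 -/G' -SGS.
  by rewrite /G !mulmxA.
have gTg : g^T *m g == 1%:M by rewrite (mulmx1C ggT).
exists (Orth gTg); rewrite /=.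
have gy : g *m y = (y' : 'M_n.+1) *m g.
  apply: (can_inj (mulKmx uP')); rewrite !mulmxA gE PA' -mulmxA PA.
  by rewrite -[RHS]mulmxA gE !mulmxA diag_mxC.
split; first by rewrite gy -mulmxA ggT mulmx1.
(* The eigenvalue 0 occurs, and its rows in [P] and [P'] are [w] and [w'], of equal square. So the
   scaling there is 1 and [g] links the two vectors. *)
have [i s_i] : exists i : 'I_n.+1, s`_i = 0.
  have : 0 \in s.
    have : root (char_poly y) 0.
      rewrite -eigenvalue_root_char; apply/eigenvalueP; exists w => //.
      by rewrite scale0r.
    by rewrite (char_poly_distinct eig_s) root_prod_XsubC.
  move=> s0; have lt_i : (index 0%R s < n.+1)%N by rewrite -size_s index_mem.
  by exists (Ordinal lt_i); rewrite /= nth_index.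
have ww (Q : 'M[F]_n.+1) x : row i Q = x -> (Q *m Q^T) i i = (x *m x^T) 0 0.
  by move=> <-; rewrite !mxE; apply: eq_bigr => k _; rewrite !mxE.
have c1 : c i = 1.
  have eq_ii : s`_i = - s`_i by rewrite s_i oppr0.
  rewrite /c /G /G' ((gram y P uP PA i i).2 eq_ii).2 ((gram y' P' uP' PA' i i).2 eq_ii).2.
  by rewrite (ww _ _ (P0 i s_i)) (ww _ _ (P0' i s_i)) -eq_ww divff // sqrtC1.
have w'g : w' *m g = w.
  rewrite -(P0' i s_i) -(P0 i s_i) -row_mul gE.
  by rewrite row_diag_mx_mul mxE c1 scale1r.
by rewrite -w'g -mulmxA ggT mulmx1.
Qed.

End Eigenvalues.

(** * Translation to a point with [w y = 0], the discriminant, and linked points *)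

Section GenericOrbits.
Variables (F : numClosedFieldType) (l : nat).
Local Notation n := l.*2.
Local Notation dual := (dualC F n.+1).
Implicit Types lam mu : dual.

Definition wnorm lam : F := (lam.2 *m lam.2^T) 0 0.

Lemma psi0_wnorm lam : psi 0 lam = - wnorm lam.
Proof. exact: psi0E. Qed.

Lemma wwE lam : lam.2 *m lam.2^T = (wnorm lam)%:M.
Proof. by apply/matrixP => i j; rewrite !ord1 [RHS]mxE eqxx mulr1n. Qed.

Lemma wnorm_polynomial : polynomial_function wnorm.
Proof.
apply/polynomial_functionE.
apply: (generated_ext (f := fun lam : dual => \sum_k lam.2 0 k * lam.2 0 k)).
  by move=> lam; rewrite /wnorm mxE; apply: eq_bigr => k _; rewrite mxE.
by apply: generated_sum => k _; apply: generatedM; apply: polynomial_w.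
Qed.

(* wnorm lam times the component of the coadjoint translate of lam that kills w *)
Definition kernel_part lam : 'M[F]_n.+1 :=
  wnorm lam *: (lam.1 : 'M_n.+1) - (lam.1 : 'M_n.+1) *m (lam.2^T *m lam.2) -
  (lam.2^T *m lam.2) *m (lam.1 : 'M_n.+1).

(** Nonzero exactly when [w w^T] is nonzero and the translate of [lam] with [w y = 0] has distinct
    eigenvalues. *)
Definition discr lam : F :=
  wnorm lam * \det (horner_mx (kernel_part lam) (char_poly (kernel_part lam))^`()).

Lemma kernel_part_polynomial i j :
  polynomial_function (fun lam => kernel_part lam i j).
Proof.
apply/polynomial_functionE.
have Pww i' j' : polynomial_function (fun lam : dual => (lam.2^T *m lam.2) i' j').
  apply: (@generated_mulmx F dual) => a b; last exact: polynomial_w.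
  apply: (generated_ext (f := fun lam : dual => lam.2 b a)) => [lam|].
    by rewrite mxE.
  exact: polynomial_w.
have Py i' j' := @polynomial_y F n.+1 i' j'.
apply: (generated_ext (f := fun lam : dual =>
   wnorm lam * (lam.1 : 'M_n.+1) i j -
   ((lam.1 : 'M_n.+1) *m (lam.2^T *m lam.2)) i j -
   ((lam.2^T *m lam.2) *m (lam.1 : 'M_n.+1)) i j)) => [lam|].
  rewrite /kernel_part; move: (_ *m (_ *m _)) (_ *m _ *m _) => A A'.
  by rewrite !mxE.
apply: generatedB; first apply: generatedB.
- by apply: generatedM; [apply: wnorm_polynomial | apply: Py].
- exact: generated_mulmx.
exact: generated_mulmx.
Qed.

Lemma discr_polynomial : polynomial_function discr.
Proof.
apply/polynomial_functionE.
apply: generatedM; first exact: wnorm_polynomial.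
have Ppow k i j : polynomial_function (fun lam => (kernel_part lam ^+ k) i j).
  elim: k i j => [|k IHk] i j.
    exact: (generated_const _ ((1 : 'M[F]_n.+1) i j)).
  apply: (generated_ext (f := fun lam =>
      (kernel_part lam *m kernel_part lam ^+ k) i j)) => [lam|].
    by rewrite exprS.
  by apply: generated_mulmx => // a b; apply: kernel_part_polynomial.
apply: generated_det => i j.
apply: (generated_ext (f := fun lam => \sum_(k < n.+1)
   (char_poly (kernel_part lam))^`()`_k * (kernel_part lam ^+ k) i j)) => [lam|].
  set q := _^`(); have size_q : (size q <= n.+1)%N.
    by rewrite -ltnS -(size_char_poly (kernel_part lam)) lt_size_deriv ?char_poly_neq0.
  have -> : horner_mx (kernel_part lam) q =
      \sum_(k < n.+1) q`_k *: kernel_part lam ^+ k.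
    have {1}-> : q = \poly_(k < n.+1) q`_k.
      apply/polyP => k; rewrite coef_poly; case: ltnP => // le_k.
      by rewrite nth_default // (leq_trans size_q).
    rewrite poly_def rmorph_sum; apply: eq_bigr => k _.
    by rewrite /= horner_mxZ rmorphXn /= horner_mx_X.
  by rewrite summxE; apply: eq_bigr => k _; rewrite mxE.
apply: generated_sum => k _; apply: generatedM; last exact: Ppow.
apply: (generated_ext (f := fun lam => (char_poly (kernel_part lam))`_k.+1 * k.+1%:R)).
  by move=> lam; rewrite coef_deriv mulr_natr.
apply: generatedM; last exact: generated_const.
by apply: pgenerated_char_poly => a b; apply: kernel_part_polynomial.
Qed.

Lemma coad_kernel lam : wnorm lam != 0 ->
  exists h : IO F n.+1, [/\ isISO h,
    (coad h lam).2 = lam.2, (coad h lam).2 *m (coad h lam).1 = 0 &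
    kernel_part lam = wnorm lam *: ((coad h lam).1 : 'M_n.+1)].
Proof.
case: lam => y w nzs; set s := wnorm _ in nzs *.
(* Acting by [u] adds [u w - w^T u^T] to [y]. As [w y w^T = 0], this [u] satisfies [w u = 0], and
   [w w^T u^T = w y] cancels [w y]. *)
pose u : 'cV[F]_n.+1 := - s^-1 *: ((y : 'M_n.+1) *m w^T).
have yT := eqP (so_skew y).
have wyw : w *m y *m w^T = 0.
  have /matrixP/(_ 0 0) : (w *m y *m w^T)^T = - (w *m y *m w^T).
    by rewrite !trmx_mul trmxK yT mulNmx mulmxN mulmxA.
  move: (w *m y *m w^T) => A /eqP; rewrite !mxE -addr_eq0 -mulr2n mulrn_eq0 /= => /eqP A0.
  by apply/matrixP => i j; rewrite !ord1 A0 mxE.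
have uT : u^T = s^-1 *: (w *m y).
  by rewrite /u linearZ /= trmx_mul trmxK yT mulmxN scalerN scaleNr opprK.
have wu0 : w *m u = 0 by rewrite /u -scalemxAr mulmxA wyw scaler0.
have ww : w *m w^T = s%:M by exact: (wwE (y, w)).
pose h : IO F n.+1 := (orth1 F n.+1, u).
have [hy hw] : ((coad h (y, w)).1 : 'M_n.+1) = (y : 'M_n.+1) + (u *m w - w^T *m u^T) /\
    (coad h (y, w)).2 = w.
  have inv1 : invmx 1%:M = 1%:M :> 'M[F]_n.+1 by rewrite -[RHS](mulVmx (unitmx1 _ _)) mulmx1.
  by rewrite /= inv1 !mulmx1 mul1mx trmx_mul.
exists h; rewrite hy hw; split=> //; first by rewrite /isISO /= det1.
  rewrite mulmxDr mulmxBr !mulmxA wu0 mul0mx sub0r ww mul_scalar_mx uT scalerA.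
  by rewrite divff // scale1r subrr.
rewrite /kernel_part /= -/s scalerDr scalerBr uT /u -scalemxAl -scalemxAr !scalerA.
by rewrite mulrN divff // scaleN1r scale1r !mulmxA addrA.
Qed.

Lemma h_mx_eigenvalue (a : 'I_l -> F) k x : x ^+ 2 = - a k ^+ 2 ->
  eigenvalue (h_mx a : 'M_n.+1) x.
Proof.
move=> x2; apply/eigenvalueP; have [a0|nza] := eqVneq (a k) 0.
  (* For [a k = 0] the eigenvector used below would be 0; the last basis vector serves instead. *)
  move: x2; rewrite a0 expr0n oppr0 => /eqP; rewrite sqrf_eq0 => /eqP ->.
  exists (delta_mx 0 ord_max); first by rewrite h_mx_last scale0r.
  by apply/eqP => /matrixP/(_ 0 ord_max)/eqP; rewrite !mxE !eqxx oner_eq0.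
exists (x *: delta_mx 0 (block_index k false) + a k *: delta_mx 0 (block_index k true)).
  rewrite mulmxDl -!scalemxAl !h_mx_row /= scalerDr !scalerA mulrN -!expr2 x2.
  by rewrite addrC [x * _]mulrC.
apply/eqP => /matrixP/(_ 0 (block_index k true))/eqP.
by rewrite !mxE !block_index_eq !eqxx /= mulr0 add0r mulr1 (negPf nza).
Qed.

Lemma eigenvalue0_kernel (A : 'M[F]_n.+1) (w : 'rV[F]_n.+1) :
  w *m A = 0 -> w != 0 -> eigenvalue A 0.
Proof. by move=> wA nz_w; apply/eigenvalueP; exists w; rewrite // scale0r. Qed.

(** The eigenvalues at these parameters are 0 and plus or minus ['i * k] for [1 <= k <= l], all
    distinct. So the generic locus is not empty. *)
Lemma h_point_discr : discr (h_point (fun k : 'I_l => k.+1%:R) 1) != 0.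
Proof.
set a := fun k : 'I_l => _; set lam := h_point _ _.
have norm1 : wnorm lam = 1 by rewrite /wnorm h_point_norm expr1n.
have wy0 : lam.2 *m lam.1 = 0 by exact: h_point_kernel.
have yw0 : (lam.1 : 'M_n.+1) *m lam.2^T = 0.
  by rewrite -[lam.1 : 'M_n.+1]trmxK -trmx_mul (eqP (so_skew _)) mulmxN wy0 oppr0 trmx0.
have nz_w : lam.2 != 0.
  by apply/eqP => w0; move: norm1; rewrite /wnorm w0 mul0mx mxE => /esym/eqP; rewrite oner_eq0.
have -> : discr lam = \det (horner_mx lam.1 (char_poly lam.1)^`()).
  rewrite /discr /kernel_part norm1 scale1r mul1r !mulmxA yw0 mul0mx subr0.
  by rewrite -mulmxA wy0 mulmx0 subr0.
apply/distinct_eigenvaluesP.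
pose r (c : F) := [seq c * a k | k <- enum 'I_l].
exists (0 :: r 'i ++ r (- 'i)).
have size_r c : size (r c) = l by rewrite size_map size_enum_ord.
have nzi : 'i != 0 :> F by apply: neq0Ci.
have r_uniq c : c != 0 -> uniq (r c).
  move=> nzc; rewrite map_inj_uniq ?enum_uniq // => i j /(mulfI nzc) /eqP.
  by rewrite eqr_nat eqSS => /eqP /val_inj.
have nz_r c : c != 0 -> 0 \notin r c.
  move=> nzc; apply/mapP => [[k _ /esym/eqP]].
  by rewrite mulf_eq0 (negPf nzc) pnatr_eq0.
split.
- rewrite cons_uniq mem_cat negb_or !nz_r ?oppr_eq0 // cat_uniq !r_uniq ?oppr_eq0 //=.
  rewrite andbT; apply/hasPn => x /mapP[k _ ->]; apply/mapP => [[j _ /eqP]].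
  rewrite mulNr -mulrN (inj_eq (mulfI nzi)) eq_sym -addr_eq0 -natrD pnatr_eq0.
  by rewrite addSn.
- by rewrite -[LHS]/(size (r 'i ++ r (- 'i))).+1 size_cat !size_r addnn.
move=> x; rewrite inE => /predU1P[->|].
  exact: eigenvalue0_kernel wy0 nz_w.
by rewrite mem_cat => /orP[] /mapP[k _ ->]; apply: (@h_mx_eigenvalue a k);
  rewrite exprMn ?sqrrN sqrCi mulN1r.
Qed.

(* For the last two clauses, the sign c is the determinant of an orthogonal matrix
   linking lam to mu. *)
Definition linked lam mu := exists c : F,
  [/\ c ^+ 2 = 1, Phi mu = c * Phi lam, forall f, J f -> f mu = f lam &
      c = 1 -> forall f, Yc f -> f mu = f lam].

Lemma J_Yc (f : dual -> F) : J f -> Yc f.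
Proof. by case=> Pf Jf; split=> // h lam mu _; apply: Jf. Qed.

Lemma Yc_coad (f : dual -> F) h lam : Yc f -> isISO h -> f (coad h lam) = f lam.
Proof. by case=> _ Yf det_h; apply: Yf det_h (coadP h lam). Qed.

(** A translation brings [lam] to a point with [w y = 0] and spectrum [s]; [orth_conj_distinct] then
    leads to [mu]. The factor [wnorm lam] in the hypothesis on [s] is the one carried by
    [kernel_part]. *)
Lemma linked_eigen lam mu s :
  wnorm lam != 0 -> wnorm mu = wnorm lam -> mu.2 *m mu.1 = 0 ->
  (forall x, x \in s -> eigenvalue (kernel_part lam) (wnorm lam * x)) ->
  uniq s -> size s = n.+1 -> (forall x, x \in s -> eigenvalue mu.1 x) ->
  linked lam mu.
Proof.
move=> nzs eq_s wy0' eig uniq_s size_s eig'.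
have [h [det_h w_h wy0 kerE]] := coad_kernel nzs.
have [lam' lam'E] : exists lam', lam' = coad h lam by exists (coad h lam).
rewrite -lam'E in w_h wy0 kerE.
have eig_lam' : distinct_eigenvalues lam'.1 s.
  split=> // x /eig; rewrite kerE => /eigenvalueP[v vE nz_v].
  apply/eigenvalueP; exists v => //; apply: (scalemx_inj nzs) => /=.
  by rewrite scalemxAr vE scalerA.
have [g [gy gw]] : exists g : orth F n.+1,
    (g : 'M_n.+1) *m lam'.1 *m (g : 'M_n.+1)^T = mu.1 /\
    lam'.2 *m (g : 'M_n.+1)^T = mu.2.
  apply: (orth_conj_distinct eig_lam') => //; rewrite w_h; last exact: nzs.
  by rewrite !wwE eq_s.
have muE : mu = coad (g, 0) lam'.
  apply: dual_eq; last by rewrite /= orth_inv gw.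
  by rewrite -gy /= orth_inv mul0mx linear0 subr0 addr0.
exists (\det (g : 'M_n.+1)); split.
- exact: orth_det_sqr.
- by rewrite muE Phi_coad lam'E Phi_coad det_h mul1r.
- move=> f Jf; rewrite -(Yc_coad lam (J_Yc Jf) det_h) -lam'E muE.
  by case: Jf => _ Jf; apply: Jf (coadP _ _).
by move=> det_g f Yf; rewrite -(Yc_coad lam Yf det_h) -lam'E muE (Yc_coad _ Yf).
Qed.

End GenericOrbits.
(** * The slice *)

Lemma char_block_mx (R : nzRingType) (m n : nat) (A : 'M[R]_m) (B : 'M_(m, n))
    (C : 'M_(n, m)) (D : 'M_n) :
  char_poly_mx (block_mx A B C D) =
  block_mx (char_poly_mx A) (- map_mx polyC B) (- map_mx polyC C) (char_poly_mx D).
Proof.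
rewrite /char_poly_mx map_block_mx scalar_mx_block opp_block_mx add_block_mx.
by rewrite !add0r.
Qed.

Section Slice.
Variable F : numClosedFieldType.
Local Notation pc := (map_mx polyC).

Lemma dot2 (R : pzRingType) (u v : 'rV[R]_2) :
  (u *m v^T) 0 0 = u 0 0 * v 0 0 + u 0 1 * v 0 1.
Proof.
by rewrite mxE !big_ord_recl big_ord0 addr0 !mxE;
   congr (_ + u 0 _ * v 0 _); apply: val_inj.
Qed.

Lemma char_poly_nilpotent n (A : 'M[F]_n) :
  (forall r, eigenvalue A r -> r = 0) -> char_poly A = 'X^n.
Proof.
move=> eig0; have [s sE] := closed_field_poly_normal (char_poly A).
move: sE; have /monicP -> := char_poly_monic A; rewrite scale1r => sE.
have size_s : size s = n.
  by apply: succn_inj; rewrite -(size_char_poly A) sE size_prod_XsubC.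
rewrite sE -size_s -[size s]muln1 -sum1_size mulnC big_distrr /=.
rewrite (eq_bigr (fun=> 1%N)) => [|i _]; last by rewrite muln1.
rewrite -(prodrXr 'X) big_seq [RHS]big_seq; apply: eq_bigr => x s_x.
by rewrite (eig0 x) ?subr0 // eigenvalue_root_char sE root_prod_XsubC.
Qed.

(* eps is isotropic; omega c has square - c and pairing 'i with eps. *)
Definition eps : 'rV[F]_2 := \row_j (if j == 0 then 1 else 'i).
Definition omega (c : F) : 'rV[F]_2 :=
  \row_j (if j == 0 then 'i / 2 * (c + 1) else 'i / 2 * ('i * (c - 1))).

Lemma ii : 'i * 'i = -1 :> F. Proof. by rewrite -expr2 sqrCi. Qed.

Lemma eps_eps : eps *m eps^T = 0.
Proof.
by apply/matrixP => i j; rewrite !ord1 dot2 !mxE /= mul1r ii subrr.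
Qed.

Lemma omega_eps c : omega c *m eps^T = ('i)%:M.
Proof.
apply/matrixP => i j; rewrite !ord1 dot2 !mxE /= mulr1n.
have -> : 'i / 2 * ('i * (c - 1)) * 'i = ('i * 'i) * 'i / 2 * (c - 1) :> F by ring.
by rewrite ii; field; rewrite ?pnatr_eq0.
Qed.

Lemma omega_omega c : omega c *m (omega c)^T = (- c)%:M.
Proof.
apply/matrixP => i j; rewrite !ord1 dot2 !mxE /= mulr1n.
transitivity (('i * 'i) / 4%:R * ((c + 1) ^+ 2 + ('i * 'i) * (c - 1) ^+ 2)) => //.
  by field; rewrite ?pnatr_eq0.
by rewrite ii; field; rewrite ?pnatr_eq0.
Qed.

Section Step.
Variable n : nat.

Lemma slice_skew (lam : dualC F n) :
  (block_mx 0 (eps^T *m lam.2) (- (lam.2^T *m eps)) lam.1)^T ==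
  - block_mx 0 (eps^T *m lam.2) (- (lam.2^T *m eps)) lam.1.
Proof.
rewrite tr_block_mx opp_block_mx trmx0 oppr0 opprK (eqP (so_skew lam.1)).
by rewrite linearN /= !trmx_mul !trmxK.
Qed.

(** Raises the dimension by 2. For nilpotent [lam.1] the new matrix is again nilpotent, and [Psi]
    only gains a top term [c X^(n+1)]. *)
Definition slice_step (c : F) (lam : dualC F n) : dualC F (2 + n) :=
  (So (slice_skew lam), row_mx (omega c) 0).

(** For an eigenvector [(a, b)] with [r != 0], [a] is a multiple of [eps], so [a eps^T = 0] by
    isotropy. This decouples [b], which must be 0, and then [a = 0]. *)
Lemma slice_step_eigenvalue c (lam : dualC F n) :
  (forall r, eigenvalue (lam.1 : 'M_n) r -> r = 0) ->
  forall r, eigenvalue ((slice_step c lam).1 : 'M_(2 + n)) r -> r = 0.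
Proof.
move=> eig0 r /eigenvalueP[v vE nz_v]; apply/eqP; apply: contraNT nz_v => nz_r.
move: vE; rewrite -[v]hsubmxK; set a := lsubmx v; set b := rsubmx v.
rewrite /= mul_row_block mulmx0 add0r scale_row_mx => /eq_row_mx [eq_a eq_b].
have a_eps : a *m eps^T = 0.
  apply: (scalemx_inj nz_r); rewrite /= scalemxAl -eq_a mulmxN mulNmx.
  by rewrite -!mulmxA eps_eps !mulmx0 oppr0 scaler0.
have b0 : b = 0.
  apply/eqP; apply: contraNT nz_r => nz_b; apply/eqP/eig0/eigenvalueP.
  by exists b => //; rewrite -eq_b mulmxA a_eps mul0mx add0r.
have a0 : a = 0.
  by apply: (scalemx_inj nz_r); rewrite /= -eq_a b0 mul0mx scaler0.
by rewrite a0 b0 row_mx0.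
Qed.

End Step.

(** A solution of [(X - y) z = X^(n+3) w^T] is built from the solution [z'] in the smaller
    dimension, and [Psi_solution] reads off [Psi]. *)
Lemma slice_step_Psi n c (lam : dualC F n.+1) :
  char_poly lam.1 = 'X^(n.+1) ->
  char_poly (slice_step c lam).1 = 'X^(n.+3) ->
  Psi (slice_step c lam : dualC F n.+3) = c *: 'X^(n.+2) + Psi lam.
Proof.
move=> charX' charX; pose W := pc lam.2; pose E := pc eps; pose O := pc (omega c).
pose z' := \adj (char_poly_mx lam.1) *m W^T.
have z'E : char_poly_mx lam.1 *m z' = 'X^(n.+1) *: W^T.
  by rewrite mulmxA mul_mx_adj mul_scalar_mx -charX'.
have Wz' : W *m z' = (- Psi lam)%:M.
  apply/matrixP => i j; rewrite !ord1 [RHS]mxE /= mulr1n /Psi opprK.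
  by rewrite /z' mulmxA.
have EO : E *m O^T = ('i%:P)%:M.
  rewrite -[LHS]trmxK trmx_mul trmxK /E map_trmx -map_mxM omega_eps.
  by rewrite map_scalar_mx tr_scalar_mx.
have OE : O *m E^T = ('i%:P)%:M by rewrite /E map_trmx -map_mxM omega_eps map_scalar_mx.
have EE : E *m E^T = 0 by rewrite map_trmx -map_mxM eps_eps map_mx0.
have OO : O *m O^T = (- c%:P)%:M.
  by rewrite map_trmx -map_mxM omega_omega map_scalar_mx /= polyCN.
have iiP : 'i%:P * 'i%:P = -1 :> {poly F} by rewrite -polyCM ii polyCN.
(* The [E^T] term cancels the contribution of [z'] to the first block; the factor [- 'i X] on [z']
   cancels that of [E O^T = 'i] to the second. *)
pose A := 'X^(n.+2) *: O^T + ('i%:P * Psi lam) *: E^T.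
pose z : 'cV[{poly F}]_(2 + n.+1) := col_mx A (- ('i%:P * 'X) *: z').
have wz : pc (slice_step c lam).2 *m z = O *m A.
  have -> : pc (slice_step c lam).2 = row_mx O 0 :> 'rV_(2 + n.+1).
    by rewrite /= map_row_mx map_mx0.
  exact: etrans (mul_row_col _ _ _ _) (etrans (congr1 _ (mul0mx _ _)) (addr0 _)).
have yE : char_poly_mx (slice_step c lam).1 =
    block_mx 'X%:M (- (E^T *m W)) (W^T *m E) (char_poly_mx lam.1) :> 'M_(2 + n.+1).
  rewrite [LHS]char_block_mx {1}/char_poly_mx map_mx0 subr0 map_mxN opprK !map_mxM.
  by rewrite -!map_trmx.
have wT : (pc (slice_step c lam).2)^T = col_mx O^T 0 :> 'cV_(2 + n.+1).
  by rewrite /= map_row_mx map_mx0 tr_row_mx trmx0.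
have yz : char_poly_mx (slice_step c lam).1 *m z =
    'X^(n.+3) *: (pc (slice_step c lam).2)^T.
  rewrite yE wT /z; apply: (etrans (mul_block_col _ _ _ _ _ _)).
  apply: etrans (esym (scale_col_mx _ _ _)); rewrite scaler0 mul_scalar_mx.
  congr col_mx.
    rewrite mulNmx -scalemxAr -mulmxA Wz' mul_mx_scalar scaleNr opprK.
    rewrite /A scalerDr !scalerA -addrA -scalerDl -exprS.
    have -> : 'X * ('i%:P * Psi lam) + 'i%:P * 'X * - Psi lam = 0 by ring.
    by rewrite scale0r addr0.
  rewrite -scalemxAr z'E -mulmxA /A mulmxDr -!scalemxAr EO EE scaler0 addr0.
  rewrite -scalemxAr mul_mx_scalar !scalerA -scalerDl.
  have -> : 'X^(n.+2) * 'i%:P + - ('i%:P * 'X) * 'X^(n.+1) = 0 :> {poly F}.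
    by rewrite exprS; ring.
  by rewrite scale0r.
rewrite (@Psi_solution F n.+2 (slice_step c lam) z) ?charX // wz.
rewrite /A mulmxDr -!scalemxAr OO OE -!mul_polyC.
have scal (a b : {poly F}) : (a *: b%:M : 'M_1) 0 0 = a * b.
  by rewrite !mxE mulr1n.
rewrite [X in - X]mxE !scal.
transitivity (c%:P * 'X^(n.+2) - 'i%:P * 'i%:P * Psi lam); first by ring.
by rewrite iiP mulN1r opprK.
Qed.

(** After [l] shifts the base case is [y = 0] with [w] the single entry [c l]; it contributes
    [- c_l^2] to [Psi], while the other parameters enter [Psi] linearly. *)
Fixpoint slice (l : nat) (c : nat -> F) : dualC F l.*2.+1 :=
  if l is l'.+1 then slice_step (c 0) (slice l' (fun k => c k.+1))
  else (skew_part 0, const_mx (c 0)).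

Lemma slice_eigenvalue l c r :
  eigenvalue ((slice l c).1 : 'M_(l.*2.+1)) r -> r = 0.
Proof.
elim: l c r => [|l IHl] c r; last first.
  exact: (@slice_step_eigenvalue _ _ (slice l (fun k => c k.+1)) (IHl _) r).
move=> /eigenvalueP[v /= vE nz_v]; apply/eqP; apply: contraNT nz_v => nz_r.
apply/eqP/(scalemx_inj nz_r); rewrite /= -vE trmx0 subr0 mulmx0.
by rewrite scaler0.
Qed.

Lemma Psi_slice l c : Psi (slice l c) =
  \sum_(k < l) c k *: 'X^((l - k).*2) - (c l ^+ 2)%:P.
Proof.
elim: l c => [|l IHl] c.
  rewrite big_ord0 sub0r Psi_sum big_ord1 /= expr0 alg_polyC B0 mulmx1.
  by rewrite !mxE big_ord1 !mxE polyCN expr2.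
have char_slice m d := char_poly_nilpotent (@slice_eigenvalue m d).
rewrite (@slice_step_Psi l.*2 (c 0) (slice l (fun k => c k.+1))) ?IHl; last first.
- exact: (char_slice l.+1 c).
- exact: char_slice.
by rewrite big_ord_recl /= subn0 addrA.
Qed.

Lemma psi_slice l c k : (k < l)%N -> psi k (slice l c) = c k.
Proof.
move=> lt_kl; rewrite psi_Psi ?leq_double 1?ltnW // Psi_slice -doubleB.
rewrite coefB coefC double_eq0 subn_eq0 leqNgt lt_kl subr0 coef_sum.
rewrite (bigD1 (Ordinal lt_kl)) //= coefZ coefXn eqxx mulr1 big1 ?addr0 // => i ne_i.
rewrite coefZ coefXn; case: eqP => [/double_inj eq_i|]; last by rewrite mulr0.
case/eqP: ne_i; apply: val_inj => /=.
by rewrite -(subKn (ltnW lt_kl)) eq_i subKn // ltnW.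
Qed.

Lemma psi_slice_last l c : psi l (slice l c) = - c l ^+ 2.
Proof.
rewrite psi_Psi // Psi_slice subnn coefB coefC /= coef_sum big1 ?sub0r // => i _.
by rewrite coefZ coefXn eq_sym double_eq0 subn_eq0 leqNgt ltn_ord mulr0.
Qed.

Lemma slice_generated l (T : Type) m (gen : 'I_m -> T -> F) (c : nat -> T -> F) :
  (forall k, generated gen (c k)) ->
  (forall i j, generated gen (fun t =>
     ((slice l (fun k => c k t)).1 : 'M_(l.*2.+1)) i j)) /\
  (forall i j, generated gen (fun t => (slice l (fun k => c k t)).2 i j)).
Proof.
elim: l c => [|l IHl] c Gc.
  split=> i j.
    apply: (generated_ext (f := fun=> 0)) => [t|]; first by rewrite /= trmx0 subr0 mxE.
    exact: generated_const.
  by apply: (generated_ext (f := c 0)) => [t|//]; rewrite mxE.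
have [Gy Gw] := IHl (fun k => c k.+1) (fun k => Gc k.+1).
pose y t : 'M[F]_(2 + l.*2.+1) := (slice l.+1 (fun k => c k t)).1.
pose w t : 'rV[F]_(2 + l.*2.+1) := (slice l.+1 (fun k => c k t)).2.
have G0 i j : generated gen (fun t => eps^T i j) by exact: generated_const.
suff [Hy Hw] : (forall i j, generated gen (fun t => y t i j)) /\
  (forall i j, generated gen (fun t => w t i j)) by split=> i j; [apply: Hy | apply: Hw].
split=> i j.
  rewrite -(splitK i) -(splitK j).
  case: (split i) (split j) => [i1|i2] [j1|j2] /=.
  - apply: (generated_ext (f := fun=> 0)) => [t|]; last exact: generated_const.
    by rewrite /y block_mxEul mxE.
  - apply: (generated_ext (f := fun t =>
      (eps^T *m (slice l (fun k => c k.+1 t)).2) i1 j2)) => [t|].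
      by rewrite /y block_mxEur.
    exact: (generated_mulmx (A := fun=> eps^T)).
  - apply: (generated_ext (f := fun t =>
      - ((slice l (fun k => c k.+1 t)).2^T *m eps) i2 j1)) => [t|].
      by rewrite /y block_mxEdl [RHS]mxE.
    apply/generatedN/generated_mulmx => [a b|a b]; last exact: generated_const.
    by apply: (generated_ext _ (Gw b a)) => t; rewrite mxE.
  apply: (generated_ext (fun t => esym (block_mxEdr _ _ _ _ i2 j2))).
  exact: Gy.
rewrite -(splitK j) (ord1 i); case: (split j) => [j1|j2] /=.
  apply: (generated_ext (f := fun t => omega (c 0%N t) 0 j1)) => [t|].
    by apply/esym; apply: row_mxEl.
  apply: (generated_ext (f := fun t => if j1 == 0 then 'i / 2 * (c 0%N t + 1)
     else 'i / 2 * ('i * (c 0%N t - 1)))) => [t|]; first by rewrite mxE.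
  have Gk x : generated gen (fun=> x) by exact: generated_const.
  have G1 x : generated gen (fun t => c 0%N t + x) by exact: generatedD (Gc 0%N) (Gk x).
  case: (j1 == 0); first exact: generatedM (Gk _) (G1 _).
  exact: generatedM (Gk _) (generatedM (Gk _) (G1 _)).
apply: (generated_ext (f := fun=> 0)) => [t|]; last exact: generated_const.
by apply: etrans (esym (row_mxEr _ _ _ _)); rewrite mxE.
Qed.

End Slice.
(** * Invariants *)

Section Invariants.
Variables (F : numClosedFieldType) (l : nat).
Local Notation n := l.*2.
Local Notation dual := (dualC F n.+1).
Implicit Types lam mu : dual.

Lemma discr_wnorm lam : discr lam != 0 -> wnorm lam != 0.
Proof. by rewrite mulf_eq0 negb_or => /andP[]. Qed.

Lemma root_XPsi lam x : lam.2 *m lam.1 = 0 -> wnorm lam != 0 ->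
  root ('X * Psi lam) x = eigenvalue lam.1 x.
Proof.
by move=> wy0 nzs; rewrite Psi_kernel // eigenvalue_root_char rootZ // oppr_eq0.
Qed.

(** The translate with [w y = 0] has the same [Psi], and there [X Psi] is a nonzero multiple of the
    characteristic polynomial. Its eigenvalues are those of [kernel_part] divided by [wnorm lam]. *)
Lemma discr_eigen lam : discr lam != 0 -> exists s, [/\ uniq s, size s = n.+1,
  forall x, x \in s -> eigenvalue (kernel_part lam) (wnorm lam * x) &
  forall x, x \in s -> root ('X * Psi lam) x].
Proof.
move=> nzd; have nzs := discr_wnorm nzd.
have [s [uniq_s size_s eig]] : exists s, distinct_eigenvalues (kernel_part lam) s.
  by apply/distinct_eigenvaluesP; move: nzd; rewrite mulf_eq0 negb_or => /andP[].
have eig' x : x \in [seq z / wnorm lam | z <- s] ->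
    eigenvalue (kernel_part lam) (wnorm lam * x).
  by case/mapP => z s_z ->; rewrite mulrC divfK // eig.
exists [seq z / wnorm lam | z <- s]; split=> //.
- by rewrite map_inj_uniq // => x z; apply: mulIf; rewrite invr_eq0.
- by rewrite size_map.
move=> x /eig'; have [h [_ w_h wy0 kerE]] := coad_kernel nzs.
rewrite -(Psi_coad h) root_XPsi // ?/wnorm ?w_h // kerE.
move=> /eigenvalueP[v vE nz_v]; apply/eigenvalueP; exists v => //.
by apply: (scalemx_inj nzs); rewrite /= scalemxAr vE scalerA.
Qed.

(** [Psi] determines the norm, through its coefficient [psi 0], and the spectrum of the translate of
    [mu] with [w y = 0]. So [linked_eigen] applies to that translate, and translating back changes
    neither [Phi] nor the elements of [Yc]. *)
Lemma linked_Psi lam mu : discr lam != 0 -> Psi mu = Psi lam -> linked lam mu.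
Proof.
move=> nzd eqPsi; have nzs := discr_wnorm nzd.
have eq_s : wnorm mu = wnorm lam.
  by apply: oppr_inj; rewrite -!psi0_wnorm !psi_Psi // eqPsi.
have nzs' : wnorm mu != 0 by rewrite eq_s.
have [h [det_h w_h wy0 _]] := coad_kernel nzs'.
have [s [uniq_s size_s eig rootP]] := discr_eigen nzd.
have eq_s' : wnorm (coad h mu) = wnorm mu by rewrite /wnorm w_h.
have [c [c2 cPhi cJ cY]] : linked lam (coad h mu).
  apply: (linked_eigen nzs) uniq_s size_s _ => //; first by rewrite eq_s'.
  by move=> x /rootP; rewrite -eqPsi -(Psi_coad h) root_XPsi // eq_s'.
exists c; split=> //.
- by rewrite -cPhi Phi_coad det_h mul1r.
- by move=> f Jf; rewrite -(cJ f Jf) (Yc_coad _ (J_Yc Jf)).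
by move=> c1 f Yf; rewrite -(cY c1 f Yf) (Yc_coad _ Yf).
Qed.

(** The spectrum of [h_point a b] consists of 0 and the square roots of the [- a_k^2], so these are
    taken to be the roots of [Psi2 lam], whose leading coefficient is [- wnorm lam]. The sign of [b]
    stays free. *)
Lemma linked_h_point lam : discr lam != 0 -> exists a : 'I_l -> F,
  psi l lam = - (wnorm lam * \prod_k a k ^+ 2) /\
  forall b, b ^+ 2 = wnorm lam -> linked lam (h_point a b).
Proof.
move=> nzd; have nzs := discr_wnorm nzd.
have lead : (Psi2 lam)`_l = - wnorm lam by rewrite -psi0_wnorm -coef_Psi2 // subn0.
have size_E : size (Psi2 lam) = l.+1.
  apply/eqP; rewrite eqn_leq size_Psi2 /= ltnNge; apply/negP => le_l.
  by move: nzs; rewrite -oppr_eq0 -lead nth_default ?eqxx.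
have [ts tsE] := closed_field_poly_normal (Psi2 lam).
have leadE : lead_coef (Psi2 lam) = - wnorm lam by rewrite lead_coefE size_E.
rewrite leadE in tsE.
have size_ts : size ts = l.
  apply: succn_inj; rewrite -size_E tsE size_scale ?oppr_eq0 //.
  by rewrite size_prod_XsubC.
pose a (k : 'I_l) := sqrtC (- ts`_k).
have aE k : - a k ^+ 2 = ts`_k by rewrite sqrtCK opprK.
exists a; split.
  rewrite -coef_Psi2 // subnn -horner_coef0 {1}tsE hornerZ horner_prod mulNr.
  congr (- (_ * _)); rewrite (big_nth 0) big_mkord size_ts.
  by apply: eq_bigr => k _; rewrite hornerXsubC sub0r -aE opprK.
move=> b b2; have nzb : b != 0.
  by apply: contraNneq nzs => b0; rewrite -b2 b0 expr0n.
have [s [uniq_s size_s eig rootP]] := discr_eigen nzd.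
apply: (linked_eigen nzs) uniq_s size_s _ => //.
- by rewrite /wnorm h_point_norm.
- exact: h_point_kernel.
move=> x /rootP; rewrite rootM => /orP[].
  rewrite /root hornerX => /eqP ->; apply: eigenvalue0_kernel (h_point_kernel a b) _.
  by rewrite scaler_eq0 (negPf nzb); apply/eqP => /matrixP/(_ 0 ord_max)/eqP;
     rewrite !mxE !eqxx oner_eq0.
rewrite Psi_Psi2 root_comp hornerXn tsE rootZ ?oppr_eq0 // root_prod_XsubC.
move=> /(nthP 0) [k lt_k xE]; rewrite size_ts in lt_k.
by apply: (@h_mx_eigenvalue F l a (Ordinal lt_k)); rewrite aE /= xE.
Qed.

Lemma Phi_h a b : Phi (h_point a b : dual) = b * \prod_k a k.
Proof. exact: Phi_h_point. Qed.

(** At a generic point the identity is read off from a linked point of h; the linking sign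
    disappears in the square. Density gives the rest. *)
Lemma psi_Phi lam : psi l lam = - Phi lam ^+ 2.
Proof.
move: lam; apply: (polynomial_function_dense (@discr_polynomial F l) _ _
  (h_point_discr F l)).
- by apply: psi_polynomial; rewrite leqnn.
- exact/generatedN/generatedX/Phi_polynomial.
move=> lam nzd; have [a [psiE linkedE]] := linked_h_point nzd.
have [c [c2 cPhi _ _]] := linkedE _ (sqrtCK _).
rewrite psiE; congr (- _); transitivity (Phi (h_point a (sqrtC (wnorm lam))) ^+ 2).
  by rewrite Phi_h exprMn sqrtCK prodrXl.
by rewrite cPhi exprMn c2 mul1r.
Qed.

Lemma Psi_eq lam mu :
  (forall k, (k <= l)%N -> psi k lam = psi k mu) -> Psi lam = Psi mu.
Proof.
move=> eq_psi; rewrite !Psi_Psi2; congr (_ \Po _); apply/polyP => j.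
have [lt_lj|le_jl] := ltnP l j.
  by rewrite !nth_default // (leq_trans (size_Psi2 _)).
by rewrite -(subKn le_jl) !coef_Psi2 ?leq_subr // eq_psi ?leq_subr.
Qed.

Definition section (c : 'I_l.+1 -> F) : dual := slice l (fun k => c (inord k)).
Local Notation coords := (fun (i : 'I_l.+1) (c : 'I_l.+1 -> F) => c i).

Lemma inord_max : inord l = ord_max :> 'I_l.+1.
Proof. by apply: val_inj; rewrite /= inordK. Qed.

Lemma section_generated (f : dual -> F) :
  polynomial_function f -> generated coords (fun c => f (section c)).
Proof.
apply: generated_comp => i.
have [Gy Gw] := @slice_generated F l _ _ coords (fun k c => c (inord k))
  (fun k => generated_gen coords (inord k)).
rewrite -(splitK i); case: (split i) => [j|j] /=.
  case/mxvec_indexP: j => a b; apply: (generated_ext _ (Gy a b)) => c.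
  by rewrite /dual_coord row_mxEl mxvecE.
by apply: (generated_ext _ (Gw 0 j)) => c; rewrite /dual_coord row_mxEr.
Qed.

Lemma coords_dense (D f : ('I_l.+1 -> F) -> F) c0 :
  generated coords D -> generated coords f -> D c0 != 0 ->
  (forall c, D c * f c = 0) -> forall c, f c = 0.
Proof.
move=> GD Gf nzD Df0 c.
apply: (@generated_dense _ _ _ coords D f c c0
  (fun t i => c i + t * (c0 i - c i))) => //.
- move=> i; apply: generatedD; first exact: generated_const.
  apply: generatedM; last exact: generated_const.
  exact: (generated_gen (fun _ t => t) ord0).
- by move=> i; rewrite mul0r addr0.
by move=> i; rewrite mul1r addrC subrK.
Qed.

(** By [psi_Phi], [Phi^2 = c_l^2] along the slice. A product of polynomial functions vanishes only
    if a factor does, so one sign holds for all [c]. *)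
Lemma Phi_section : exists2 e : F, e * e = 1 &
  forall c, Phi (section c) = e * c ord_max.
Proof.
have GPhi := section_generated (@Phi_polynomial F l).
have Glast := generated_gen coords ord_max.
have sqr c : Phi (section c) ^+ 2 = c ord_max ^+ 2.
  by apply: oppr_inj; rewrite -psi_Phi psi_slice_last inord_max.
(* The two factors differ by 2 at [one], so they are not both 0 there; this point decides the
   sign. *)
pose one : 'I_l.+1 -> F := fun=> 1.
have prod0 c : (Phi (section c) + c ord_max) * (Phi (section c) - c ord_max) = 0.
  by rewrite mulrC -subr_sqr sqr subrr.
have [v0|nz_v] := eqVneq (Phi (section one) + one ord_max) 0.
  exists (-1) => [|c]; first by rewrite mulrNN mulr1.
  have nz_u : Phi (section one) - one ord_max != 0.
    move: v0 => /eqP; rewrite addr_eq0 => /eqP ->.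
    by rewrite -opprD oppr_eq0 /one -mulr2n pnatr_eq0.
  apply/eqP; rewrite mulN1r -addr_eq0; apply/eqP; move: c.
  apply: (@coords_dense _ _ one (generatedB GPhi Glast) (generatedD GPhi Glast) nz_u).
  by move=> c; rewrite mulrC prod0.
exists 1 => [|c]; first by rewrite mulr1.
apply/eqP; rewrite mul1r -subr_eq0; apply/eqP; move: c.
exact: (@coords_dense _ _ one (generatedD GPhi Glast) (generatedB GPhi Glast) nz_v prod0).
Qed.

(** Parameters of the slice point to be compared with [lam]; [x] will be plus or minus [Phi lam]. *)
Definition invariants lam (x : F) (i : 'I_l.+1) : F :=
  if (i < l)%N then psi i lam else x.

Lemma invariants_max lam x : invariants lam x ord_max = x.
Proof. by rewrite /invariants ltnn. Qed.

Lemma Psi_section lam x : x ^+ 2 = Phi lam ^+ 2 ->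
  Psi (section (invariants lam x)) = Psi lam.
Proof.
move=> x2; apply: Psi_eq => k; rewrite leq_eqVlt => /orP[/eqP ->|lt_kl].
  by rewrite psi_slice_last inord_max invariants_max psi_Phi x2.
by rewrite psi_slice // /invariants inordK ?lt_kl // ltnW.
Qed.

Lemma invariants_generated m (gen : 'I_m -> dual -> F) (g : dual -> F) h :
  (forall k : 'I_l.+1, (k < l)%N -> generated gen (psi k)) -> generated gen g ->
  generated coords h -> generated gen (fun lam => h (invariants lam (g lam))).
Proof.
move=> Gpsi Gg; apply: generated_comp => i; rewrite /invariants.
by case: ltnP => [/Gpsi|].
Qed.

Lemma invariants_polynomial (f g : dual -> F) :
  polynomial_function f -> polynomial_function g ->
  polynomial_function (fun lam => f (section (invariants lam (g lam)))).
Proof.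
move=> Pf Pg; apply: (invariants_generated _ Pg (section_generated Pf)) => k lt_kl.
by apply: psi_polynomial; rewrite leq_double ltnW.
Qed.

Lemma discr_Phi_polynomial : polynomial_function (fun lam => discr lam * Phi lam).
Proof. by apply: generatedM; [apply: discr_polynomial | apply: Phi_polynomial]. Qed.

Lemma h_point_discr_Phi (lam := h_point (fun k : 'I_l => k.+1%:R : F) 1 : dual) :
  discr lam * Phi lam != 0.
Proof.
rewrite mulf_neq0 ?h_point_discr // Phi_h mul1r.
by apply/prodf_neq0 => k _; rewrite pnatr_eq0.
Qed.

(** The factor [e] compensates the sign of [Phi] on the slice, so both points have the same [Phi].
    Where [discr] and [Phi] are not 0 this forces the linking sign to be 1, and density extends the
    equality. *)
Lemma Yc_section (f : dual -> F) e : Yc f -> e * e = 1 ->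
  (forall c, Phi (section c) = e * c ord_max) ->
  forall lam, f lam = f (section (invariants lam (e * Phi lam))).
Proof.
move=> Yf e2 PhiE; have [Pf _] := Yf.
apply: (polynomial_function_dense discr_Phi_polynomial Pf _ h_point_discr_Phi).
  apply: (invariants_polynomial Pf); apply: generatedM (Phi_polynomial F l).
  exact: generated_const.
move=> lam; rewrite mulf_eq0 negb_or => /andP[nzd nzPhi]; apply/esym.
have [|c [_ cPhi _]] := linked_Psi (mu := section (invariants lam (e * Phi lam))) nzd.
  by rewrite Psi_section // exprMn expr2 e2 mul1r.
apply=> //; apply: (mulIf nzPhi); rewrite -cPhi PhiE invariants_max mulrA e2.
by rewrite mul1r.
Qed.

(** Elements of [J] agree at linked points whatever the linking sign, so both values of [e] are
    allowed. *)
Lemma J_section (f : dual -> F) e : J f -> e ^+ 2 = 1 ->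
  forall lam, f lam = f (section (invariants lam (e * Phi lam))).
Proof.
move=> Jf e2; have [Pf _] := Jf.
apply: (polynomial_function_dense (@discr_polynomial F l) Pf _ (h_point_discr F l)).
  apply: (invariants_polynomial Pf); apply: generatedM (Phi_polynomial F l).
  exact: generated_const.
move=> lam nzd; apply/esym.
have [|c [_ _ -> //]] := linked_Psi (mu := section (invariants lam (e * Phi lam))) nzd.
by rewrite Psi_section // exprMn e2 mul1r.
Qed.

Lemma generated_Yc m (gen : 'I_m -> dual -> F) f :
  (forall i, Yc (gen i)) -> generated gen f -> Yc f.
Proof.
move=> Ygen [P PE]; split=> [|h lam mu det_h mu_h]; last first.
  by rewrite !PE; apply: meval_eq => i; case: (Ygen i) => _; apply; first exact: det_h.
apply/polynomial_functionE.
apply: (generated_comp (u := id) (gen := gen)) => [i|]; last by exists P.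
by case: (Ygen i).
Qed.

Lemma generated_J m (gen : 'I_m -> dual -> F) f :
  (forall i, J (gen i)) -> generated gen f -> J f.
Proof.
move=> Jgen [P PE]; split=> [|h lam mu mu_h]; last first.
  by rewrite !PE; apply: meval_eq => i; case: (Jgen i) => _; apply; exact: mu_h.
apply/polynomial_functionE.
apply: (generated_comp (u := id) (gen := gen)) => [i|]; last by exists P.
by case: (Jgen i).
Qed.

(** * Generators of [Yc] and [J], and uniqueness of [Phi] *)

Definition psi_Phi_family (k : 'I_l.+1) : dual -> F :=
  if (k < l)%N then psi k else @Phi F l.

Lemma Yc_generated f : Yc f <-> generated psi_Phi_family f.
Proof.
split=> [Yf|]; last first.
  apply: generated_Yc => i; rewrite /psi_Phi_family; case: ltnP => [lt_il|_].
    by apply/J_Yc/psi_J/ltnW.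
  exact: Phi_Yc.
have [e e2 PhiE] := Phi_section; have [Pf _] := Yf.
apply: (generated_ext (fun lam => esym (Yc_section Yf e2 PhiE lam))).
apply: invariants_generated (section_generated Pf) => [k lt_kl|].
  by have := generated_gen psi_Phi_family k; rewrite /psi_Phi_family lt_kl.
apply: generatedM; first exact: generated_const.
by have := generated_gen psi_Phi_family ord_max; rewrite /psi_Phi_family ltnn.
Qed.

Lemma J_generated f : J f <-> generated (fun (k : 'I_l.+1) (lam : dual) => psi k lam) f.
Proof.
split=> [Jf|]; last by apply: generated_J => i; apply: psi_J; rewrite -ltnS.
have [Pf _] := Jf; have [P PE] := section_generated Pf.
(* The mean of the term [x] of [P] with last variable [Phi lam] and [- Phi lam]: odd powers cancel,
   and even ones are powers of [Phi^2 = - psi_l]. *)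
pose half (x : 'X_{1..l.+1}) lam : F := if odd (x ord_max) then 0 else
  P@_x * (\prod_(i < l) psi i lam ^+ x (widen_ord (leqnSn l) i) *
          (- psi l lam) ^+ (x ord_max)./2).
apply: (generated_ext (f := fun lam => \sum_(x <- msupp P) half x lam)); last first.
  apply: generated_sum => x _; rewrite /half.
  have Gpsi k : generated (fun (k : 'I_l.+1) (lam : dual) => psi k lam) (psi (k : 'I_l.+1)).
    exact: (generated_gen (fun (k : 'I_l.+1) (lam : dual) => psi k lam) k).
  case: odd; first exact: generated_const.
  apply: generatedM; first exact: generated_const.
  apply: generatedM; last exact/generatedX/generatedN/(Gpsi ord_max).
  by apply: generated_prod => i _; apply/generatedX/(Gpsi (widen_ord (leqnSn l) i)).
move=> lam; have two0 : (2 : F) != 0 by rewrite pnatr_eq0.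
have e1 : f lam = P.@[invariants lam (Phi lam)].
  by rewrite (J_section Jf (expr1n F 2) lam) mul1r PE.
have e2 : f lam = P.@[invariants lam (- Phi lam)].
  have N1 : (-1) ^+ 2 = 1 :> F by rewrite sqrrN expr1n.
  by rewrite (J_section Jf N1 lam) mulN1r PE.
apply: (mulfI two0); transitivity (f lam + f lam); last by rewrite mulr_natl mulr2n.
rewrite {1}e1 {1}e2 !mevalE -big_split mulr_sumr; apply: eq_bigr => x _ /=.
have monom y : \prod_i invariants lam y i ^+ x i =
    \prod_(i < l) psi i lam ^+ x (widen_ord (leqnSn l) i) * y ^+ x ord_max.
  rewrite big_ord_recr /= invariants_max; congr (_ * _); apply: eq_bigr => i _.
  by rewrite /invariants /= ltn_ord.
rewrite !monom -!mulrDr exprNn -signr_odd /half; case: ifP => odd_x.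
  by rewrite mulN1r subrr !mulr0.
by rewrite mul1r psi_Phi opprK -exprM mul2n even_halfK ?odd_x //; ring.
Qed.

(** At a generic point with [Phi lam != 0], the sign of [b] is chosen so that the linked point of h
    has the same [Phi]. Then the linking sign is 1 and the value of [f] is its value on h. *)
Lemma Phi_unique (f : dual -> F) : Yc f -> restricts_to_phi f -> @Phi F l =1 f.
Proof.
move=> Yf fh; have [Pf _] := Yf.
apply: (polynomial_function_dense discr_Phi_polynomial (@Phi_polynomial F l) Pf
  h_point_discr_Phi).
move=> lam; rewrite mulf_eq0 negb_or => /andP[nzd nzPhi].
have [a [_ linkedE]] := linked_h_point nzd.
pose b := sqrtC (wnorm lam).
suff [b' [b2 PhiE]] : exists b', b' ^+ 2 = wnorm lam /\
    Phi (h_point a b' : dual) = Phi lam.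
  have [c [_ cPhi _ cY]] := linkedE b' b2.
  rewrite -(cY _ f Yf); last by apply: (mulIf nzPhi); rewrite -cPhi PhiE mul1r.
  by rewrite fh -PhiE Phi_h.
have [c [c2 cPhi _ _]] := linkedE b (sqrtCK _).
move/eqP: c2; rewrite sqrf_eq1 => /orP[] /eqP c1.
  by exists b; rewrite sqrtCK cPhi c1 mul1r.
exists (- b); rewrite sqrrN sqrtCK; split=> //.
by rewrite Phi_h mulNr -Phi_h cPhi c1 mulN1r opprK.
Qed.

End Invariants.
Theorem mainTheorem3 (R : realType) (l : nat) :
  exists Phi : dualC R[i] l.*2.+1 -> R[i],
    [/\ unique (fun f => Yc f /\ restricts_to_phi f) Phi,
        forall f : dualC R[i] l.*2.+1 -> R[i],
          J f <-> generated (fun k : 'I_l.+1 => psi k) f &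
        forall f : dualC R[i] l.*2.+1 -> R[i],
          Yc f <->
          generated (fun k : 'I_l.+1 => if (k < l)%N then psi k else Phi) f].
Proof.
exists (@Phi R[i] l); split; [|exact: J_generated|exact: Yc_generated].
split; first by split; [exact: Phi_Yc | exact: Phi_h_point].
by move=> f [Yf fh]; apply: functional_extensionality; exact: Phi_unique.
Qed.
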